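(* Let $a,b>0$ and, for $\alpha,\beta>0$, let $\psi_k=\psi_k(a,b,\alpha,\beta)$, $k=0,1,2,\ldots$, be the coefficients in the expansion $$I_x(a+\alpha,b)\,I_x(a+\beta,b)-I_x(a,b)\,I_x(a+\alpha+\beta,b)=x^{2a+\alpha+\beta}(1-x)^{2b}\sum_{k=0}^{\infty}\psi_kx^k,\qquad x\in(0,1).$$ If $\alpha$ is a positive integer and $\beta>0$, then for all $k\ge 0$ $$ \psi_k=\sum_{j=0}^{\alpha-1}\frac{\Gamma(a+b+j)\,\Gamma(a+b+\beta+\alpha-j-1)}{[\Gamma(b)]^2\,\Gamma(a+j+1)\,\Gamma(a+\beta+\alpha-j)}\left\{\frac{(a+b+j)_{k+1}}{(a+j+1)_{k+1}}-\frac{(a+b+\beta+\alpha-1-j)_{k+1}}{(a+\beta+\alpha-j)_{k+1}}\right\}. $$ Furthermore, if $0<b<1$ then $\psi_k<0$ (for all $k\ge0$) for all $\alpha,\beta>0$; and if $b>1$ then $\psi_k>0$ (for all $k\ge 0$) whenever $\alpha$ is a positive integer, $\beta\ge\alpha-1$ and $\beta>0$.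
   Context: For $a,b>0$ and $x\in(0,1)$, $I_x(a,b)=\dfrac{\int_0^x t^{a-1}(1-t)^{b-1}dt}{\int_0^1 t^{a-1}(1-t)^{b-1}dt}$ is the normalized incomplete beta function. It satisfies $I_x(a,b)=x^a(1-x)^b\sum_{n=0}^\infty\frac{\Gamma(a+b+n)}{\Gamma(b)\Gamma(a+1+n)}x^n$, so that the coefficients $\psi_k$ in the claim are well defined. $(p)_0=1$ and $(p)_n=p(p+1)\cdots(p+n-1)$ is the Pochhammer symbol. *)

(* Defs.v *)
From mathcomp Require Import all_boot all_order all_algebra.
From mathcomp Require Import all_classical all_reals all_analysis.

Set Implicit Arguments.
Unset Strict Implicit.
Unset Printing Implicit Defensive.

Import Order.TTheory GRing.Theory Num.Theory.
Import numFieldTopology.Exports numFieldNormedType.Exports.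

Local Open Scope classical_set_scope.
Local Open Scope ring_scope.

(* The integral converges for s > 0; outside this range the value is not
   meaningful. *)
Definition Gamma {R : realType} (s : R) : R :=
  \int[lebesgue_measure]_(t in `]0, +oo[) (t `^ (s - 1) * expR (- t)).

Definition inc_beta {R : realType} (x a b : R) : R :=
  \int[lebesgue_measure]_(t in `]0, x[) (t `^ (a - 1) * (1 - t) `^ (b - 1)).

(* I_x(a, b), meant for 0 < x < 1 and a, b > 0. The open intervals of
   integration avoid the endpoints, where the integrand may be singular. *)
Definition reg_inc_beta {R : realType} (x a b : R) : R :=
  inc_beta x a b / inc_beta 1 a b.

Definition pochhammer {R : realType} (p : R) (n : nat) : R :=
  \prod_(i < n) (p + i%:R).

Definition turan_beta {R : realType} (a b alpha beta x : R) : R :=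
  reg_inc_beta x (a + alpha) b * reg_inc_beta x (a + beta) b
  - reg_inc_beta x a b * reg_inc_beta x (a + alpha + beta) b.

Definition is_psi {R : realType} (a b alpha beta : R) (c : nat -> R) : Prop :=
  forall x : R, 0 < x < 1 ->
    cvgn (pseries c x) /\
    turan_beta a b alpha beta x =
      x `^ (2 * a + alpha + beta) * (1 - x) `^ (2 * b) * limn (pseries c x).

(* A power series is determined by its sum on ]0, 1[, so at most one sequence
   satisfies is_psi. *)
Definition psi {R : realType} (a b alpha beta : R) : nat -> R :=
  xget (fun=> 0) [set c | is_psi a b alpha beta c].

(* Main.v *)
Require Import Defs.
From mathcomp Require Import all_boot all_order all_algebra.
From mathcomp Require Import all_classical all_reals all_analysis.
From mathcomp Require Import measurable_realfun ring lra.
Import Order.TTheory GRing.Theory Num.Theory.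
Import numFieldTopology.Exports numFieldNormedType.Exports.
Local Open Scope classical_set_scope.
Local Open Scope ring_scope.

Set Implicit Arguments.
Unset Strict Implicit.
Unset Printing Implicit Defensive.

(* Write I_x(u, b) = x^u (1-x)^b g(u) + I_x(u+1, b) with g(u) = 1 / (u B(u, b)), by parts.
   Iterating gives I_x(u, b) = x^u (1-x)^b sum_n g(u+n) x^n, so psi_k is a difference of two
   Cauchy products of shifts of g, which telescopes when alpha is an integer.
   The interpolation M(s + h d) <= (M(s + d) / M(s))^h M(s) of Mellin integrals gives the
   beta-gamma relation (as in Bohr-Mollerup), hence g(u) = Gamma(u+b) / (Gamma(b) Gamma(u+1)).
   For b < 1, g is a positive multiple of B(u+b, 1-b), hence strictly log-convex, and the terms
   m and k-m of psi_k have a negative sum. For b > 1, all the telescoped terms are >= 0, because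
   (u+b)_n / (u+1)_n decreases in u. *)

(** Everything is derived from the integrals themselves. The uniqueness argument that compares B(a,
    b) Gamma(a + b) with Gamma(a) takes the place of the usual double integral, and the same
    interpolation inequality later gives the log-convexity of g. It yields only a weak inequality,
    while the sign of psi_k has to be strict; the recurrence of g supplies the strictness. Iterating
    the integration by parts needs I_x(u + n, b) -> 0, although the normalizing integral B(u + n, b)
    tends to 0 as well. Its decay is controlled by the partial sums of the same expansion at a point
    y between x and 1. Since [psi] is a choice among the sequences satisfying [is_psi], computing it
    also requires that a power series vanishing on ]0, 1[ be zero. *)

(** * Improper integrals and the fundamental theorem of calculus *)

Section exhaustion.
Variables (R : realType) (D : set R) (u v : nat -> R).
Local Notation mu := (@lebesgue_measure R).

(** The integrands may be singular at the ends of [D]. The fundamental theorem is therefore applied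
    on the compact intervals, and monotone convergence carries the result over to [D]. *)
Definition exhausts :=
  [/\ open D, forall n, u n < v n,
      {homo u : m n / (m <= n)%N >-> n <= m},
      {homo v : m n / (m <= n)%N >-> m <= n}
    & D = \bigcup_n `[u n, v n]%classic].

Hypothesis Duv : exhausts.

Lemma exhausts_measurable : measurable (D : set (measurableTypeR R)).
Proof. by case: Duv => oD _ _ _ _; exact: open_measurable. Qed.

Lemma exhausts_sub n : `[u n, v n]%classic `<=` D.
Proof. by case: Duv => _ _ _ _ -> x ?; exists n. Qed.

Lemma exhausts_ge0_cvg (f : R -> R) :
  measurable_fun (D : set (measurableTypeR R)) f -> (forall x, D x -> 0 <= f x) ->
  (\int[mu]_(x in `[u n, v n]) (f x)%:E)%E @[n --> \oo] -->
  (\int[mu]_(x in D) (f x)%:E)%E.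
Proof.
move=> mf f0; case: (Duv) => _ _ hu hv ->.
apply: ge0_nondecreasing_set_cvg_integral.
- move=> m n mn; rewrite subsetEset => x /=; rewrite !in_itv /= => /andP[h1 h2].
  by rewrite (le_trans (hu _ _ mn) h1) (le_trans h2 (hv _ _ mn)).
- by move=> n; exact: measurable_itv.
- by move=> n; apply: measurable_funS (exhausts_measurable) (@exhausts_sub n) _; exact/measurable_EFinP.
- by move=> n x /exhausts_sub Dx; rewrite lee_fin f0.
Qed.

Variables (f F : R -> R) (A B : R).
Hypothesis cf : forall x, D x -> {for x, continuous f}.
Hypothesis dF : forall x, D x -> is_derive x 1 F (f x).

Lemma exhausts_FTC n :
  (\int[mu]_(x in `[u n, v n]) (f x)%:E = (F (v n) - F (u n))%:E)%E.
Proof.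
have uv : u n < v n by case: Duv.
have cF x : D x -> {for x, continuous F}.
  move=> Dx; apply: differentiable_continuous; apply/derivable1_diffP.
  by have [] := dF Dx.
have sub x : `[u n, v n]%classic x -> D x by exact: exhausts_sub.
rewrite (@continuous_FTC2 _ f F) //.
- apply: continuous_in_subspaceT => x /set_mem xi; exact/cf/sub.
- split.
  + by move=> x xi; have [] := dF (sub _ (subset_itv_oo_cc xi)).
  + by apply/cvg_at_right_filter/cF/sub; rewrite /= in_itv /= lexx ltW.
  + by apply/cvg_at_left_filter/cF/sub; rewrite /= in_itv /= lexx ltW.
- move=> x xi; have [_ <-] := dF (sub _ (subset_itv_oo_cc xi)).
  by rewrite derive1E.
Qed.

Lemma exhausts_measurable_fun : measurable_fun (D : set (measurableTypeR R)) f.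
Proof.
apply: open_continuous_measurable_fun; first by case: Duv.
by move=> x /set_mem; exact: cf.
Qed.

Hypothesis FA : F (u n) @[n --> \oo] --> A.
Hypothesis FB : F (v n) @[n --> \oo] --> B.

Lemma exhausts_ge0_FTC : (forall x, D x -> 0 <= f x) ->
  (\int[mu]_(x in D) (f x)%:E = (B - A)%:E)%E.
Proof.
move=> f0; apply: cvg_unique (exhausts_ge0_cvg exhausts_measurable_fun f0) _ => //.
rewrite (_ : (fun n => _) = EFin \o (fun n => F (v n) - F (u n))); last first.
  by apply/funext => n /=; exact: exhausts_FTC.
by apply: cvg_EFin; [exact: nearW | exact: cvgB].
Qed.

Lemma exhausts_ge0_integrable : (forall x, D x -> 0 <= f x) ->
  mu.-integrable D (EFin \o f).
Proof.
move=> f0; apply/integrableP; split.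
  by apply/measurable_EFinP; exact: exhausts_measurable_fun.
under eq_integral => x /set_mem Dx do rewrite /= ger0_norm ?f0//.
by rewrite exhausts_ge0_FTC // ltry.
Qed.

End exhaustion.

Section exhaustion_signed.
Variables (R : realType) (D : set R) (u v : nat -> R).
Local Notation mu := (@lebesgue_measure R).
Hypothesis Duv : exhausts D u v.
Variables (p q F : R -> R) (A B : R).
Hypotheses (cp : forall x, D x -> {for x, continuous p})
  (cq : forall x, D x -> {for x, continuous q}).
Hypotheses (p0 : forall x, D x -> 0 <= p x) (q0 : forall x, D x -> 0 <= q x).
Hypotheses (ip : mu.-integrable D (EFin \o p))
  (iq : mu.-integrable D (EFin \o q)).
Hypothesis dF : forall x, D x -> is_derive x 1 F (p x - q x).
Hypothesis FA : F (u n) @[n --> \oo] --> A.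
Hypothesis FB : F (v n) @[n --> \oo] --> B.

(** Form suited to integration by parts: the derivative [p x - q x] may change sign, so monotone
    convergence is applied to [p] and [q] separately. *)
Lemma exhausts_FTCB :
  \int[mu]_(x in D) p x - \int[mu]_(x in D) q x = B - A.
Proof.
have mD := exhausts_measurable Duv.
have fp := integrable_fin_num mD ip; have fq := integrable_fin_num mD iq.
have cvp := exhausts_ge0_cvg Duv (exhausts_measurable_fun Duv cp) p0.
have cvq := exhausts_ge0_cvg Duv (exhausts_measurable_fun Duv cq) q0.
apply: EFin_inj; rewrite EFinB /Rintegral !fineK //.
have ff : Filter (\oo : set_system nat) by exact: _.
(* Finiteness of the integral of [p] rules out an indeterminate difference of infinities. *)
have h := cvgeB (fin_num_adde_defr _ fp) cvp cvq; have {}h := h ff.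
suff e : (fun n => \int[mu]_(x in `[u n, v n]) (p x)%:E
    - \int[mu]_(x in `[u n, v n]) (q x)%:E)%E = EFin \o (fun n => F (v n) - F (u n)).
  have h' : (EFin \o (fun n => F (v n) - F (u n))) @ \oo --> (B - A)%:E.
    by apply: cvg_EFin; [exact: nearW | exact: cvgB].
  by move: h; rewrite /= [X in X @ _]e => h; rewrite -(cvg_lim _ h) // (cvg_lim _ h').
apply/funext => n /=.
have sub := @exhausts_sub _ _ _ _ Duv n.
rewrite -(@exhausts_FTC _ _ _ _ Duv (fun x => p x - q x)) //; last first.
  by move=> x Dx; apply: cvgB; [exact: cp | exact: cq].
under [in RHS]eq_integral do rewrite EFinB.
have mi : measurable (`[u n, v n]%classic : set (measurableTypeR R)) by exact: measurable_itv.
have ipn : mu.-integrable `[u n, v n]%classic (EFin \o p) by exact: (integrableS mD mi sub ip).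
have iqn : mu.-integrable `[u n, v n]%classic (EFin \o q) by exact: (integrableS mD mi sub iq).
by rewrite -(integralB mi ipn iqn).
Qed.

End exhaustion_signed.

(** * Exhaustions of ]0, r[ and ]0, +oo[, and limits along them *)

Section open_intervals.
Variable R : realType.
Implicit Types (r x : R) (n : nat).

Lemma cvg_scale_harmonic (c : R) : c * harmonic n @[n --> \oo] --> (0 : R).
Proof. by rewrite -(mulr0 c); apply: cvgM; [exact: cvg_cst | exact: cvg_harmonic]. Qed.

Lemma harmonic_le m n : (m <= n)%N -> (harmonic n : R) <= harmonic m.
Proof. by move=> mn; rewrite /= lef_pV2 ?posrE ?ltr0n// ler_nat. Qed.

(** The factor 1/3 keeps the two endpoints apart already at n = 0, where [harmonic] equals 1. *)
Lemma exhausts_oo r : 0 < r -> exhausts `]0, r[%classic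
  (fun n => r / 3 * harmonic n) (fun n => r - r / 3 * harmonic n).
Proof.
move=> r0; have h0 n : 0 < (n.+1%:R^-1 : R) by rewrite invr_gt0 ltr0n.
have h1 n : (n.+1%:R^-1 : R) <= 1 by rewrite invf_le1 ?ler1n// ltr0n.
have r30 : 0 < r / 3 by rewrite divr_gt0.
have hu n : 0 < r / 3 * n.+1%:R^-1 /\ r / 3 * n.+1%:R^-1 <= r / 3.
  by split; [exact: mulr_gt0 | rewrite ger_pMr].
split.
- by apply: interval_open.
- by move=> n; move: (hu n) => /=; set h := r / 3 * _ => -[? ?]; lra.
- by move=> m n mn; rewrite ler_pM2l // harmonic_le.
- by move=> m n mn; rewrite lerD2l lerN2 ler_pM2l // harmonic_le.
- apply/seteqP; split => [x /=|x [n _] /=]; rewrite !in_itv /=; last first.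
    by move: (hu n) => /=; set h := r / 3 * _ => -[? ?] /andP[? ?]; apply/andP; split; lra.
  move=> /andP[x0 xr].
  have m0 : 0 < Num.min x (r - x) by rewrite lt_min x0 subr_gt0.
  have /cvgrPdist_lt/(_ _ m0)[N _ /(_ N (leqnn N))] := cvg_scale_harmonic (r / 3).
  rewrite sub0r normrN gtr0_norm; last by have [] := hu N.
  rewrite lt_min => /andP[h2 h3].
  by exists N => //=; rewrite in_itv /=; apply/andP; split; [exact: ltW | rewrite lerBrDr -lerBrDl; exact: ltW].
Qed.

Lemma exhausts_oy : exhausts `]0, +oo[%classic
  (fun n => 2^-1 * harmonic n : R) (fun n => n.+1%:R).
Proof.
have h0 n : 0 < (n.+1%:R^-1 : R) by rewrite invr_gt0 ltr0n.
have h1 n : (n.+1%:R^-1 : R) <= 1 by rewrite invf_le1 ?ler1n// ltr0n.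
split.
- by apply: interval_open.
- move=> n /=; have ? := h1 n; have h2 : (1 : R) <= n.+1%:R by rewrite ler1n.
  by apply: lt_le_trans h2; rewrite ltr_pdivrMl // mulr1; apply: le_lt_trans (h1 n) _; rewrite ltr1n.
- by move=> m n mn; rewrite ler_pM2l ?invr_gt0 // harmonic_le.
- by move=> m n mn; rewrite ler_nat.
- apply/seteqP; split => [x /=|x [n _] /=]; rewrite !in_itv /= ?andbT; last first.
    by move=> /andP[+ _]; apply: lt_le_trans; rewrite mulr_gt0 ?invr_gt0.
  move=> x0.
  have /cvgrPdist_lt/(_ _ x0)[N _ hN] := cvg_scale_harmonic 2^-1.
  exists (maxn N (Num.truncn x)) => //=; rewrite in_itv /=; apply/andP; split.
    have := hN (maxn N (Num.truncn x)) (leq_maxl _ _).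
    rewrite sub0r normrN gtr0_norm; last by rewrite mulr_gt0 ?invr_gt0.
    exact: ltW.
  apply: ltW; apply: lt_le_trans (truncnS_gt x) _.
  by rewrite ler_nat ltnS leq_maxr.
Qed.

Lemma cvg_exhausts_left (F : R -> R) (A : R) (c : R) : 0 < c ->
  F x @[x --> 0^'+] --> A -> F (c * harmonic n) @[n --> \oo] --> A.
Proof.
move=> c0 /cvg_at_rightP; apply; split; last exact: cvg_scale_harmonic.
by move=> n; rewrite mulr_gt0 // harmonic_gt0.
Qed.

Lemma cvg_exhausts_right (F : R -> R) (A : R) r (c : R) : 0 < c ->
  F x @[x --> r^'-] --> A -> F (r - c * harmonic n) @[n --> \oo] --> A.
Proof.
move=> c0 /cvg_at_leftP; apply; split.
  by move=> n; rewrite gtrBl mulr_gt0 // harmonic_gt0.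
by rewrite -[X in _ --> X](subr0 r); apply: cvgB; [exact: cvg_cst | exact: cvg_scale_harmonic].
Qed.

Lemma cvg_exhausts_y (F : R -> R) (A : R) :
  F x @[x --> +oo] --> A -> F n.+1%:R @[n --> \oo] --> A.
Proof.
move=> /cvg_pinftyP; apply.
apply: (cvg_comp (fun n => n.+1) (fun n : nat => n%:R : R) _ cvgr_idn); 
  by rewrite [X in X @ _](_ : _ = fun n => (n + 1)%N); [exact: cvg_addnr | apply/funext => n; rewrite addn1].
Qed.

End open_intervals.

(** * Derivatives and boundary limits of real powers *)

Section powR_calculus.
Variable R : realType.
Implicit Types (a b t x r : R).

Lemma is_derive_continuous (f : R -> R) x df :
  is_derive x 1 f df -> {for x, continuous f}.
Proof.
by case=> d _; apply: differentiable_continuous; apply/derivable1_diffP.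
Qed.

Lemma is_derive_onem_powR b t : t < 1 ->
  is_derive t 1 (fun t => (1 - t) `^ b) (- (b * (1 - t) `^ (b - 1))).
Proof.
move=> t1.
have d1 : is_derive t 1 (fun t : R => 1 - t) (-1).
  by apply: is_derive_eq; rewrite add0r mul1r.
have d2 : is_derive (1 - t) 1 (fun x => x `^ b) (b * (1 - t) `^ (b - 1)).
  by apply: is_derive1_powR; rewrite subr_gt0.
have := @is_derive1_comp _ (fun x => x `^ b) (fun t => 1 - t) _ _ _ d2 d1.
by rewrite mulrN1.
Qed.

Lemma continuous_powR a t : 0 < t -> {for t, continuous (fun t => t `^ a)}.
Proof. by move=> t0; exact: is_derive_continuous (is_derive1_powR _ t0). Qed.

Lemma continuous_onem_powR b t :
  t < 1 -> {for t, continuous (fun t => (1 - t) `^ b)}.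
Proof. by move=> t1; exact: is_derive_continuous (is_derive_onem_powR b t1). Qed.

Lemma powRB1 t a : 0 < t -> t `^ a = t * t `^ (a - 1).
Proof.
move=> t0; have tn0 : t != 0 by rewrite gt_eqF.
by rewrite -[t in t * _]powRr1 ?ltW // -powRD ?tn0 ?implybT// addrC subrK.
Qed.

Lemma cvg_onem_powR_left b r : 0 < b -> r <= 1 ->
  (1 - t) `^ b @[t --> r^'-] --> (1 - r) `^ b.
Proof.
move=> b0; rewrite le_eqVlt => /predU1P[->|r1].
  (* At r = 1 the base reaches 0, where the derivative gives no continuity; the one-sided limit of
     the power at 0 is used along sequences instead. *)
  apply/cvg_at_leftP => u [u1 cu]; rewrite subrr powR0 ?gt_eqF//.
  have /cvg_at_rightP := powR_cvg0 b0.
  apply; split; first by move=> n; rewrite subr_gt0.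
  by rewrite -[X in _ --> X](subrr 1); apply: cvgB => //; exact: cvg_cst.
by apply: cvg_at_left_filter; exact: continuous_onem_powR.
Qed.

End powR_calculus.

(** * The incomplete beta integral: convergence and integration by parts *)

Section beta_integral.
Variable R : realType.
Local Notation mu := (@lebesgue_measure R).
Implicit Types (a b t x r : R).

Lemma integral_powR01 a : 0 < a ->
  [/\ \int[mu]_(t in `]0, 1[) (t `^ (a - 1)) = a^-1 &
  mu.-integrable `]0, 1[ (EFin \o (fun t => t `^ (a - 1)))].
Proof.
move=> a0; have an0 : a != 0 by rewrite gt_eqF.
pose F t := a^-1 * t `^ a.
have E := exhausts_oo (@ltr01 R).
have cf (t : R) : `]0, 1[%classic t -> {for t, continuous (fun t => t `^ (a - 1))}.
  by move=> /= /andP[t0 _]; exact: continuous_powR.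
have dF (t : R) : `]0, 1[%classic t -> is_derive t 1 F (t `^ (a - 1)).
  move=> /= /andP[t0 _]; have d := is_derive1_powR a t0.
  by apply: is_derive_eq; rewrite /GRing.scale /= mulrA mulVf ?mul1r.
have c3 : 0 < 1 / 3 :> R by rewrite divr_gt0.
have FA : F (1 / 3 * harmonic n) @[n --> \oo] --> a^-1 * 0.
  by apply: cvg_exhausts_left c3 _; apply: cvgM; [exact: cvg_cst | exact: powR_cvg0].
have FB : F (1 - 1 / 3 * harmonic n) @[n --> \oo] --> a^-1 * 1 `^ a.
  apply: cvg_exhausts_right c3 _; apply: cvgM; first exact: cvg_cst.
  by apply: cvg_at_left_filter; apply: continuous_powR.
have f0 (t : R) : `]0, 1[%classic t -> 0 <= t `^ (a - 1) by rewrite powR_ge0.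
split; last exact: (exhausts_ge0_integrable E cf dF FA FB f0).
rewrite /Rintegral (exhausts_ge0_FTC E cf dF FA FB f0) /= mulr0 subr0.
by rewrite powR1 mulr1.
Qed.

Lemma integral_onem_powR01 a : 0 < a ->
  [/\ \int[mu]_(t in `]0, 1[) ((1 - t) `^ (a - 1)) = a^-1 &
  mu.-integrable `]0, 1[ (EFin \o (fun t => (1 - t) `^ (a - 1)))].
Proof.
move=> a0; have an0 : a != 0 by rewrite gt_eqF.
pose F t := - a^-1 * (1 - t) `^ a.
have E := exhausts_oo (@ltr01 R).
have cf (t : R) : `]0, 1[%classic t -> {for t, continuous (fun t => (1 - t) `^ (a - 1))}.
  by move=> /= /andP[_ t1]; exact: continuous_onem_powR.
have dF (t : R) : `]0, 1[%classic t -> is_derive t 1 F ((1 - t) `^ (a - 1)).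
  move=> /= /andP[_ t1]; have d := is_derive_onem_powR a t1.
  by apply: is_derive_eq; rewrite /GRing.scale /= mulrNN mulrA mulVf ?mul1r.
have c3 : 0 < 1 / 3 :> R by rewrite divr_gt0.
have FA : F (1 / 3 * harmonic n) @[n --> \oo] --> - a^-1 * (1 - 0) `^ a.
  apply: cvg_exhausts_left c3 _; apply: cvgM; first exact: cvg_cst.
  by apply: cvg_at_right_filter; apply: continuous_onem_powR.
have FB : F (1 - 1 / 3 * harmonic n) @[n --> \oo] --> - a^-1 * (1 - 1) `^ a.
  apply: cvg_exhausts_right c3 _; apply: cvgM; first exact: cvg_cst.
  exact: cvg_onem_powR_left.
have f0 (t : R) : `]0, 1[%classic t -> 0 <= (1 - t) `^ (a - 1) by rewrite powR_ge0.
split; last exact: (exhausts_ge0_integrable E cf dF FA FB f0).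
rewrite /Rintegral (exhausts_ge0_FTC E cf dF FA FB f0) /= subrr subr0 powR1.
by rewrite powR0 // mulr0 sub0r mulr1 opprK.
Qed.

Definition beta_kernel a b t : R := t `^ (a - 1) * (1 - t) `^ (b - 1).

Lemma beta_kernel_ge0 a b t : 0 <= beta_kernel a b t.
Proof. by rewrite mulr_ge0 ?powR_ge0. Qed.

Lemma beta_kernel_continuous a b t :
  0 < t < 1 -> {for t, continuous (beta_kernel a b)}.
Proof.
by move=> /andP[t0 t1]; apply: cvgM; [exact: continuous_powR | exact: continuous_onem_powR].
Qed.

(* For t <= 1/2 the second factor is (1 - t)^b / (1 - t) <= 2, and symmetrically. *)
Lemma beta_kernel_le a b t : 0 < a -> 0 < b -> 0 < t < 1 ->
  beta_kernel a b t <= 2 * (t `^ (a - 1) + (1 - t) `^ (b - 1)).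
Proof.
move=> a0 b0 /andP[t0 t1]; rewrite /beta_kernel.
have s0 : 0 < 1 - t by rewrite subr_gt0.
have ta : t `^ a <= 1 by rewrite -[leRHS](congr1 (@^~ a) (powR1 R)) ge0_ler_powR ?nnegrE // ltW.
have tb : (1 - t) `^ b <= 1.
  by rewrite -[leRHS](congr1 (@^~ b) (powR1 R)) ge0_ler_powR ?nnegrE ?gerBl // ltW.
have := powRB1 a t0; have := powRB1 b s0.
have := powR_ge0 t (a - 1); have := powR_ge0 (1 - t) (b - 1).
set A := t `^ (a - 1); set B := (1 - t) `^ (b - 1) => B0 A0 eb ea.
rewrite mulrDr; have [h|h] := leP t (2^-1).
  have : B <= 2.
    suff : 2^-1 * B <= 1 by move=> ?; lra.
    by apply: le_trans tb; rewrite eb ler_wpM2r //; lra.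
  by move=> B2; have := ler_wpM2l A0 B2; nra.
have : A <= 2.
  suff : 2^-1 * A <= 1 by move=> ?; lra.
  by apply: le_trans ta; rewrite ea ler_wpM2r //; lra.
by move=> A2; have := ler_wpM2r B0 A2; nra.
Qed.

Lemma beta_kernel_integrable a b r : 0 < a -> 0 < b -> r <= 1 ->
  mu.-integrable `]0, r[ (EFin \o beta_kernel a b).
Proof.
move=> a0 b0 r1.
have m01 : measurable (`]0, 1[%classic : set (measurableTypeR R)) by exact: measurable_itv.
have mr : measurable (`]0, r[%classic : set (measurableTypeR R)) by exact: measurable_itv.
have sub : (`]0, r[%classic : set R) `<=` (`]0, 1[%classic : set R).
  by move=> x /=; rewrite !in_itv /= => /andP[-> h] /=; exact: lt_le_trans r1.
apply: (integrableS m01 mr sub).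
have [_ i1] := integral_powR01 a0; have [_ i2] := integral_onem_powR01 b0.
have i3 := integrableZl m01 2 (integrableD m01 i1 i2).
apply: (le_integrable m01 _ _ i3).
  apply/measurable_EFinP; apply: (exhausts_measurable_fun (exhausts_oo (@ltr01 R))).
  by move=> t /=; rewrite in_itv /=; exact: beta_kernel_continuous.
move=> t /=; rewrite in_itv /= => ht.
rewrite lee_fin !ger0_norm ?beta_kernel_ge0 ?beta_kernel_le //.
by rewrite mulr_ge0 ?addr_ge0 ?powR_ge0.
Qed.

(** The derivative of t^a (1 - t)^b is a t^(a-1) (1 - t)^b - b t^a (1 - t)^(b-1); writing (1 - t)^b
    as (1 - t) (1 - t)^(b-1) leaves kernels with the same b. The endpoint x = 1 is included: there
    the boundary term vanishes, which gives the recurrence of the complete beta integral. *)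
Lemma inc_beta_rec a b x : 0 < a -> 0 < b -> 0 < x <= 1 ->
  a * inc_beta x a b = x `^ a * (1 - x) `^ b + (a + b) * inc_beta x (a + 1) b.
Proof.
move=> a0 b0 /andP[x0 x1].
have a10 : 0 < a + 1 by rewrite addr_gt0.
have E := exhausts_oo x0.
have mx : measurable (`]0, x[%classic : set (measurableTypeR R)) by exact: measurable_itv.
have i1 := beta_kernel_integrable a0 b0 x1.
have i2 := beta_kernel_integrable a10 b0 x1.
have in01 t : `]0, x[%classic t -> 0 < t < 1.
  by rewrite /= in_itv /= => /andP[-> h] /=; exact: lt_le_trans x1.
pose p t := a * beta_kernel a b t; pose q t := (a + b) * beta_kernel (a + 1) b t.
pose F t := t `^ a * (1 - t) `^ b.
have ip : mu.-integrable `]0, x[ (EFin \o p) by have h := integrableZl mx a i1; exact: h.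
have iq : mu.-integrable `]0, x[ (EFin \o q) by have h := integrableZl mx (a + b) i2; exact: h.
have cp t : `]0, x[%classic t -> {for t, continuous p}.
  by move=> /in01 h; apply: cvgM; [exact: cvg_cst | exact: beta_kernel_continuous].
have cq t : `]0, x[%classic t -> {for t, continuous q}.
  by move=> /in01 h; apply: cvgM; [exact: cvg_cst | exact: beta_kernel_continuous].
have p0 t : `]0, x[%classic t -> 0 <= p t by rewrite mulr_ge0 ?beta_kernel_ge0 // ltW.
have q0 t : `]0, x[%classic t -> 0 <= q t.
  by rewrite mulr_ge0 ?beta_kernel_ge0 // ltW // addr_gt0.
have dF t : `]0, x[%classic t -> is_derive t 1 F (p t - q t).
  move=> /in01 /andP[t0 t1].
  have d1 := is_derive1_powR a t0; have d2 := is_derive_onem_powR b t1.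
  have s0 : 0 < 1 - t by rewrite subr_gt0.
  apply: is_derive_eq; rewrite /GRing.scale /= /p /q /beta_kernel addrK.
  by rewrite (powRB1 a t0) (powRB1 b s0); ring.
have c3 : 0 < x / 3 by rewrite divr_gt0.
have FA : F (x / 3 * harmonic n) @[n --> \oo] --> 0 * (1 - 0) `^ b.
  apply: cvg_exhausts_left c3 _; apply: cvgM; first exact: powR_cvg0.
  by apply: cvg_at_right_filter; apply: continuous_onem_powR.
have FB : F (x - x / 3 * harmonic n) @[n --> \oo] --> F x.
  apply: cvg_exhausts_right c3 _; apply: cvgM; last exact: cvg_onem_powR_left.
  by apply: cvg_at_left_filter; apply: continuous_powR.
have := exhausts_FTCB E cp cq p0 q0 ip iq dF FA FB.
rewrite /p /q (RintegralZl _ mx i1) (RintegralZl _ mx i2) mul0r subr0 => /eqP.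
by rewrite subr_eq => /eqP.
Qed.

End beta_integral.

(** * The Gamma integral: convergence and functional equation *)

Section gamma_integral.
Variable R : realType.
Local Notation mu := (@lebesgue_measure R).
Implicit Types (s t : R).

Let m0y : measurable (`]0, +oo[%classic : set (measurableTypeR R)).
Proof. exact: measurable_itv. Qed.

Let in0y t : `]0, +oo[%classic t -> 0 < t.
Proof. by rewrite /= in_itv /= andbT. Qed.

Lemma is_derive_expRN t : is_derive t 1 (fun t : R => expR (- t)) (- expR (- t)).
Proof.
have d1 : is_derive t 1 (fun t : R => - t) (-1) by apply: is_derive_eq.
have := @is_derive1_comp _ (@expR R) (fun t => - t) _ _ _ (is_derive_expR (- t)) d1.
by rewrite mulrN1.
Qed.

Definition gamma_kernel s t : R := t `^ (s - 1) * expR (- t).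

Lemma gamma_kernel_ge0 s t : 0 <= gamma_kernel s t.
Proof. by rewrite mulr_ge0 ?powR_ge0 ?expR_ge0. Qed.

Lemma gamma_kernel_continuous s t : 0 < t -> {for t, continuous (gamma_kernel s)}.
Proof.
move=> t0; apply: cvgM; first exact: continuous_powR.
exact: is_derive_continuous (is_derive_expRN t).
Qed.

(* Raise [1 + t / p <= expR (t / p)] to the power p. *)
Lemma expRN_le p t : 0 < p -> 0 < t ->
  expR (- t) <= (1 + p) `^ p * (1 + t) `^ (- p).
Proof.
move=> p0 t0; have tp0 : 0 < 1 + t by lra.
have q0 : 0 < (1 + t) `^ p by exact: powR_gt0.
rewrite expRN powRN ler_pdivlMr // mulrC ler_pdivrMr ?expR_gt0 //.
have -> : expR t = expR (t / p) `^ p by rewrite -expRM divfK // gt_eqF.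
rewrite -powRM ?expR_ge0 //; last lra.
apply: ge0_ler_powR; rewrite ?nnegrE; [lra|lra|by rewrite mulr_ge0 ?expR_ge0 //; lra|].
apply: (@le_trans _ _ ((1 + p) * (1 + t / p))); last first.
  by rewrite ler_pM2l ?expR_ge1Dx //; lra.
have tp : 0 < t / p by rewrite divr_gt0.
have e : p * (t / p) = t by rewrite mulrCA divff ?mulr1 // gt_eqF.
rewrite mulrDl mul1r mulrDr mulr1 e; move: tp; set y := t / p => tp.
by lra.
Qed.

(** This majorant has the explicit primitive (t / (1 + t))^s / s, bounded on ]0, +oo[, so a single
    function controls the Gamma kernel both at 0 and at infinity. *)
Lemma integrable_gamma_majorant s : 0 < s ->
  mu.-integrable `]0, +oo[ (EFin \o (fun t => t `^ (s - 1) * (1 + t) `^ (- (s + 1)))).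
Proof.
move=> s0; have sn0 : s != 0 by rewrite gt_eqF.
pose F t := s^-1 * (t `^ s * (1 + t) `^ (- s)).
have d1 p t : 0 < 1 + t -> is_derive t 1 (fun t => (1 + t) `^ p) (p * (1 + t) `^ (p - 1)).
  move=> t0.
  have e : is_derive t 1 (fun t : R => 1 + t) 1 by apply: is_derive_eq; rewrite add0r mulr1.
  have e2 : is_derive (1 + t) 1 (fun x => x `^ p) (p * (1 + t) `^ (p - 1)).
    exact: is_derive1_powR.
  have := @is_derive1_comp _ (fun x => x `^ p) (fun t => 1 + t) _ _ _ e2 e.
  by rewrite mulr1.
apply: (exhausts_ge0_integrable (exhausts_oy R) (F := F) (A := s^-1 * (0 * (1 + 0) `^ (- s)))
  (B := s^-1 * (1 - 0) `^ s)).
- move=> t /in0y t0; apply: cvgM; first exact: continuous_powR.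
  by apply: is_derive_continuous (d1 _ _ _); rewrite addr_gt0.
- move=> t /in0y t0; have t1 : 0 < 1 + t by rewrite addr_gt0.
  have e1 := is_derive1_powR s t0; have e2 := d1 (- s) _ t1.
  apply: is_derive_eq; rewrite /GRing.scale /=.
  have -> : - (s + 1) = - s - 1 by rewrite opprD.
  rewrite (powRB1 s t0) (powRB1 (- s) t1).
  by field.
- apply: cvg_exhausts_left => //; apply: cvgM; first exact: cvg_cst.
  apply: cvgM; first exact: powR_cvg0.
  have h01 : 0 < 1 + 0 :> R by rewrite addr0.
  apply: cvg_at_right_filter; exact: is_derive_continuous (d1 (- s) _ h01).
- apply: cvgM; first exact: cvg_cst.
  (* At t = n + 1 the quotient t / (1 + t) is 1 - 1 / (n + 2). *)
  rewrite [X in X @ _](_ : _ = (fun t => (1 - t) `^ s) \o (fun n => n.+2%:R^-1)).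
    apply: continuous_cvg; first exact: continuous_onem_powR.
    by have := @cvg_harmonic R; rewrite -cvg_shiftS.
  apply/funext => n /=; rewrite powRN -powR_inv1 ?powR_ge0 // powRAC -powRM ?powR_ge0 //.
  rewrite powR_inv1 ?addr_ge0 //; congr (_ `^ _).
  rewrite -[n.+2%:R]natr1 addrC mulrC; field.
  by rewrite gt_eqF // addr_gt0 ?ltr0n.
- by move=> t _; rewrite mulr_ge0 ?powR_ge0.
Qed.

Lemma gamma_kernel_integrable s : 0 < s ->
  mu.-integrable `]0, +oo[ (EFin \o gamma_kernel s).
Proof.
move=> s0; have s1 : 0 < s + 1 by rewrite addr_gt0.
have le t : 0 < t ->
    gamma_kernel s t <= (1 + (s + 1)) `^ (s + 1) * (t `^ (s - 1) * (1 + t) `^ (- (s + 1))).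
  by move=> t0; rewrite /gamma_kernel mulrCA ler_wpM2l ?powR_ge0 // expRN_le.
have C0 := powR_ge0 (1 + (s + 1)) (s + 1).
move: le C0; set C := (_ `^ (s + 1)) => le C0.
have i := integrableZl m0y C (integrable_gamma_majorant s0).
apply: (le_integrable m0y _ _ i).
  apply/measurable_EFinP; apply: (exhausts_measurable_fun (exhausts_oy R)).
  by move=> t /in0y t0; exact: gamma_kernel_continuous.
move=> t /in0y t0 /=; rewrite lee_fin ger0_norm ?gamma_kernel_ge0 //.
by apply: le_trans (le t t0) (ler_norm _).
Qed.

(** Using [expRN_le] with exponent s + 1, one more than the power to be beaten, leaves a bound C /
    t. *)
Lemma cvg_powR_expRN s : 0 < s -> t `^ s * expR (- t) @[t --> +oo] --> (0 : R).
Proof.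
move=> s0; pose C := (1 + (s + 1)) `^ (s + 1).
have c : C * t^-1 @[t --> +oo] --> (0 : R).
  rewrite -(mulr0 C); apply: cvgM; first exact: cvg_cst.
  by apply/gtr0_cvgV0; [exact: nbhs_pinfty_gt | exact: cvg_id].
apply: (squeeze_cvgr _ (cvg_cst 0) c); near=> t.
have t0 : 0 < t by near: t; exact: nbhs_pinfty_gt.
rewrite mulr_ge0 ?powR_ge0 ?expR_ge0 //=.
have s1 : 0 < s + 1 by lra.
apply: (le_trans (ler_wpM2l (powR_ge0 t s) (expRN_le s1 t0))).
rewrite mulrCA ler_wpM2l ?powR_ge0 //.
apply: (@le_trans _ _ (t `^ s * t `^ (- (s + 1)))).
  rewrite ler_wpM2l ?powR_ge0 // !powRN lef_pV2 ?posrE ?powR_gt0 //; last lra.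
  by apply: ge0_ler_powR; rewrite ?nnegrE; lra.
have tn0 : t != 0 by rewrite gt_eqF.
rewrite -powRD ?tn0 ?implybT //.
have -> : s + - (s + 1) = -1 by ring.
by rewrite powR_inv1 // ltW.
Unshelve. all: by end_near. Qed.

Lemma GammaS s : 0 < s -> Gamma (s + 1) = s * Gamma s.
Proof.
move=> s0; have s1 : 0 < s + 1 by lra.
have i1 := gamma_kernel_integrable s0; have i2 := gamma_kernel_integrable s1.
pose p t := s * gamma_kernel s t; pose q t := gamma_kernel (s + 1) t.
pose F t := t `^ s * expR (- t).
have ip : mu.-integrable `]0, +oo[ (EFin \o p) by have h := integrableZl m0y s i1; exact: h.
have cp t : `]0, +oo[%classic t -> {for t, continuous p}.
  by move=> /in0y h; apply: cvgM; [exact: cvg_cst | exact: gamma_kernel_continuous].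
have cq t : `]0, +oo[%classic t -> {for t, continuous q}.
  by move=> /in0y h; exact: gamma_kernel_continuous.
have p0 t : `]0, +oo[%classic t -> 0 <= p t by rewrite mulr_ge0 ?gamma_kernel_ge0 // ltW.
have q0 t : `]0, +oo[%classic t -> 0 <= q t by rewrite gamma_kernel_ge0.
have dF t : `]0, +oo[%classic t -> is_derive t 1 F (p t - q t).
  move=> /in0y t0; have d1 := is_derive1_powR s t0; have d2 := is_derive_expRN t.
  by apply: is_derive_eq; rewrite /GRing.scale /= /p /q /gamma_kernel addrK; ring.
have FA : F (2^-1 * harmonic n) @[n --> \oo] --> 0 * expR (- 0).
  apply: cvg_exhausts_left => //; apply: cvgM; first exact: powR_cvg0.
  by apply: cvg_at_right_filter; exact: is_derive_continuous (is_derive_expRN 0).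
have FB : F n.+1%:R @[n --> \oo] --> (0 : R).
  exact: cvg_exhausts_y (cvg_powR_expRN s0).
have := exhausts_FTCB (exhausts_oy R) cp cq p0 q0 ip i2 dF FA FB.
rewrite /p /q (RintegralZl _ m0y i1) mul0r subr0 => /eqP.
by rewrite subr_eq0 => /eqP.
Qed.

Lemma Gamma1 : Gamma (1 : R) = 1.
Proof.
pose F t := - expR (- t).
have k1 t : gamma_kernel 1 t = expR (- t) by rewrite /gamma_kernel subrr powRr0 mul1r.
have cf t : `]0, +oo[%classic t -> {for t, continuous (gamma_kernel 1)}.
  by move=> /in0y h; exact: gamma_kernel_continuous.
have dF t : `]0, +oo[%classic t -> is_derive t 1 F (gamma_kernel 1 t).
  move=> /in0y t0; have d2 := is_derive_expRN t.
  by apply: is_derive_eq; rewrite k1 opprK.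
have FA : F (2^-1 * harmonic n) @[n --> \oo] --> - expR (- 0).
  apply: cvg_exhausts_left => //; apply: cvgN.
  by apply: cvg_at_right_filter; exact: is_derive_continuous (is_derive_expRN 0).
have FB : F n.+1%:R @[n --> \oo] --> (- 0 : R).
  by apply: cvg_exhausts_y; apply: cvgN; exact: cvgr_expR.
have f0 t : `]0, +oo[%classic t -> 0 <= gamma_kernel 1 t by rewrite gamma_kernel_ge0.
have := exhausts_ge0_FTC (exhausts_oy R) cf dF FA FB f0.
by rewrite /Gamma /Rintegral /gamma_kernel => ->; rewrite /= oppr0 expR0 sub0r opprK.
Qed.

End gamma_integral.

(** * Interpolation inequality for Mellin integrals *)

Section mellin.
Variable R : realType.
Local Notation mu := (@lebesgue_measure R).

Lemma le_Rintegral_subset (A B : set R) (f : R -> R) :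
  measurable (A : set (measurableTypeR R)) ->
  measurable (B : set (measurableTypeR R)) -> A `<=` B ->
  (forall t, B t -> 0 <= f t) -> mu.-integrable B (EFin \o f) ->
  \int[mu]_(t in A) f t <= \int[mu]_(t in B) f t.
Proof.
move=> mA mB AB f0 iB; have iA := integrableS mB mA AB iB.
apply: fine_le; [exact: integrable_fin_num iA|exact: integrable_fin_num iB|].
apply: ge0_subset_integral => //; first by case/integrableP: iB.
Qed.

Lemma powR_le_weighted_mean (h y : R) : 0 <= h <= 1 -> 0 < y -> y `^ h <= 1 - h + h * y.
Proof.
move=> /andP[h0 h1] y0; rewrite /powR gt_eqF //.
have {2}-> : y = expR (ln y) by rewrite lnK.
(* Both values, e^z and 1, are bounded below by the tangent line of exp at h z. In the combination
   with weights h and 1 - h the terms linear in z cancel. *)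
set z := ln y; have e0 := expR_gt0 (h * z).
have e1 : expR (h * z) * (1 + (1 - h) * z) <= expR z.
  have -> : expR z = expR (h * z) * expR ((1 - h) * z) by rewrite -expRD; congr expR; ring.
  by rewrite ler_pM2l // expR_ge1Dx.
have e2 : expR (h * z) * (1 - h * z) <= 1.
  have e3 : expR (h * z) * expR (- (h * z)) = 1 by rewrite -expRD subrr expR0.
  by rewrite -[leRHS]e3 ler_pM2l // expR_ge1Dx.
have h1' : 0 <= 1 - h by lra.
have := ler_wpM2l h0 e1; have := ler_wpM2l h1' e2.
set E := expR (h * z) in e0 e1 e2 *; set G := expR z in e1 *; nra.
Qed.

Variables (D : set R) (w : R -> R).
Hypothesis mD : measurable (D : set (measurableTypeR R)).
Hypothesis D0 : forall t, D t -> 0 < t.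
Hypothesis w0 : forall t, D t -> 0 <= w t.

(** Common form of Gamma and of the beta integral as a function of its first parameter, so that one
    inequality serves both. *)
Definition mellin (s : R) : R := \int[mu]_(t in D) (t `^ (s - 1) * w t).

Let iM (s : R) := mu.-integrable D (EFin \o (fun t => t `^ (s - 1) * w t)).

(** This is Hölder's inequality, that is, log-convexity of M. It is written with the ratio M(x + d)
    / M(x) because for d = 1 the functional equations make this ratio explicit. The constant c below
    is that ratio: integrating the pointwise bound then gives weights (1 - h) + h = 1. *)
Lemma mellin_interpolation (x d h : R) : 0 <= h <= 1 ->
  iM x -> iM (x + d) -> iM (x + h * d) -> 0 < mellin x -> 0 < mellin (x + d) ->
  mellin (x + h * d) <= (mellin (x + d) / mellin x) `^ h * mellin x.
Proof.
move=> h01 i0 i1 ih M0 M1.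
have [c c0 [ec Mc]] : exists2 c, 0 < c & c = mellin (x + d) / mellin x
    /\ mellin (x + d) = c * mellin x.
  exists (mellin (x + d) / mellin x); first exact: divr_gt0.
  by split=> //; rewrite divfK // gt_eqF.
rewrite -ec.
have C0 : 0 < c `^ h by exact: powR_gt0.
have e : c `^ h * mellin x =
  \int[mu]_(t in D) (c `^ h * (1 - h) * (t `^ (x - 1) * w t)
    + c `^ h * (h / c) * (t `^ (x + d - 1) * w t)).
  have j0 := integrableZl mD (c `^ h * (1 - h)) i0.
  have j1 := integrableZl mD (c `^ h * (h / c)) i1.
  rewrite (RintegralD mD j0 j1) (RintegralZl _ mD i0) (RintegralZl _ mD i1).
  rewrite -/(mellin x) -/(mellin (x + d)).
  rewrite Mc; set M := mellin x; set C := c `^ h.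
  by field; rewrite gt_eqF.
rewrite e; apply: (le_Rintegral mD ih).
  have j0 := integrableZl mD (c `^ h * (1 - h)) i0.
  have j1 := integrableZl mD (c `^ h * (h / c)) i1.
  by have j := integrableD mD j0 j1; exact: j.
move=> t Dt; have t0 := D0 Dt; have tn0 : t != 0 by rewrite gt_eqF.
have e1 : t `^ (x + d - 1) = t `^ d * t `^ (x - 1).
  by rewrite -powRD ?tn0 ?implybT //; congr (_ `^ _); ring.
have e2 : t `^ (x + h * d - 1) = (t `^ d) `^ h * t `^ (x - 1).
  by rewrite -powRrM -powRD ?tn0 ?implybT //; congr (_ `^ _); ring.
have d0 : 0 < t `^ d by exact: powR_gt0.
(* The weighted mean inequality at y = t^d / c, multiplied by c^h. *)
have step : (t `^ d) `^ h <= c `^ h * (1 - h) + c `^ h * (h / c) * t `^ d.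
  have y0 : 0 < t `^ d / c by exact: divr_gt0.
  have e3 : (t `^ d) `^ h = c `^ h * (t `^ d / c) `^ h.
    rewrite -powRM; [|exact: ltW|exact: ltW].
    by congr (_ `^ _); rewrite mulrC divfK // gt_eqF.
  have := powR_le_weighted_mean h01 y0; rewrite e3 -(ler_pM2l C0).
  move=> /le_trans; apply.
  by rewrite le_eqVlt; apply/orP; left; apply/eqP; ring.
have P0 : 0 <= t `^ (x - 1) * w t by rewrite mulr_ge0 ?powR_ge0 ?w0.
have := ler_wpM2r P0 step; rewrite e1 e2.
rewrite mulrDl !mulrA; exact.
Qed.

End mellin.

(** * Uniqueness of the Gamma function up to a constant factor *)

Section bohr_mollerup.
Variable R : realType.

(** The third clause (Wendel's inequality) is log-convexity between x and x + 1, with f (x + 1) / f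
    x replaced by x. Only this much is needed for uniqueness, and it passes easily to the product
    with the beta integral. *)
Definition gamma_like (f : R -> R) :=
  [/\ forall x, 0 < x -> 0 < f x, forall x, 0 < x -> f (x + 1) = x * f x
    & forall x h, 0 < x -> 0 <= h <= 1 -> f (x + h) <= x `^ h * f x].

Lemma gamma_like_addn f x n : gamma_like f -> 0 < x ->
  f (x + n%:R) = (\prod_(i < n) (x + i%:R)) * f x.
Proof.
move=> [_ fS _] x0; elim: n => [|n IH]; first by rewrite big_ord0 addr0 mul1r.
rewrite -natr1 addrA fS ?ltr_wpDr //.
by rewrite IH big_ord_recr /= [RHS]mulrAC mulrC.
Qed.

(** The quotient q = f / g has period 1, so q x can be evaluated far out, at N + h with N a large
    integer and h the fractional part of x. There the third clause pins f and g down up to a factor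
    1 + 1 / N. *)
Lemma gamma_like_le f g x : gamma_like f -> gamma_like g -> 0 < x ->
  f x / g x <= f 1 / g 1.
Proof.
move=> Hf Hg x0; have [f0 fS fh] := Hf; have [g0 gS gh] := Hg.
pose q y := f y / g y.
have q0 y : 0 < y -> 0 < q y by move=> y0; rewrite divr_gt0 ?f0 ?g0.
have qn y n : 0 < y -> q (y + n%:R) = q y.
  move=> y0; rewrite /q (gamma_like_addn n Hf y0) (gamma_like_addn n Hg y0).
  rewrite -mulf_div divff ?mul1r // prodf_seq_neq0; apply/allP => i _ /=.
  by rewrite gt_eqF // ltr_wpDr.
pose m := Num.truncn x; pose h := x - m%:R.
have h01 : 0 <= h <= 1.
  have mx : m%:R <= x by rewrite truncn_le ltW.
  have xm : x < m.+1%:R by exact: truncnS_gt.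
  by rewrite -natr1 in xm; apply/andP; split; rewrite /h; lra.
have key n : q x <= (1 + (n + m).+1%:R^-1) * q 1.
  set N : R := (n + m).+1%:R.
  have N0 : 0 < N by rewrite ltr0n.
  have eN : x + n.+1%:R = N + h by rewrite /N /h -addSn natrD; ring.
  rewrite -(qn x n.+1) // eN -(qn 1 (n + m)%N) // [1 + (n + m)%:R]addrC natr1 -/N.
  have Nh0 : 0 < N + h by lra.
  have h1 := fh N h N0 h01.
  (* For f the clause is used from N to N + h, an upper bound; for g from N + h to N + 1, which
     bounds g (N + h) from below. *)
  have h01' : 0 <= 1 - h <= 1 by lra.
  have := gh (N + h) (1 - h) Nh0 h01'.
  rewrite (_ : N + h + (1 - h) = N + 1); last ring.
  rewrite gS // => h2.
  have h3 : N `^ h * (N + h) `^ (1 - h) <= N + 1.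
    have N10 : 0 < N + 1 by lra.
    apply: (@le_trans _ _ ((N + 1) `^ h * (N + 1) `^ (1 - h))).
      apply: ler_pM; rewrite ?powR_ge0 //; apply: ge0_ler_powR; rewrite ?nnegrE; lra.
    rewrite -powRD; last by rewrite (gt_eqF N10) implybT.
    by rewrite [h + _]addrC subrK powRr1 // ltW.
  rewrite /q ler_pdivrMr ?g0 //.
  have -> : (1 + N^-1) * (f N / g N) * g (N + h)
    = (N + 1) * (f N * (g (N + h) / (N * g N))).
    by field; rewrite !gt_eqF ?g0.
  apply: (le_trans h1).
  have : N `^ h * f N * 1 <= N `^ h * f N * ((N + h) `^ (1 - h) * (g (N + h) / (N * g N))).
    have gN0 : 0 < N * g N by rewrite mulr_gt0 ?g0.
    have h4 : 1 <= (N + h) `^ (1 - h) * (g (N + h) / (N * g N)).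
      by rewrite [leRHS]mulrA ler_pdivlMr // mul1r.
    by apply: ler_wpM2l h4; rewrite mulr_ge0 ?powR_ge0 // ltW // f0.
  rewrite mulr1 => /le_trans; apply.
  set r := g (N + h) / _; have r0 : 0 < r by rewrite divr_gt0 ?mulr_gt0 ?g0.
  rewrite (_ : _ * _ * _ = (N `^ h * (N + h) `^ (1 - h)) * (f N * r)); last ring.
  by rewrite ler_wpM2r // mulr_ge0 ?ltW ?f0.
rewrite -/(q x) -/(q 1) leNgt; apply/negP => lt.
have d0 : 0 < q x - q 1 by rewrite subr_gt0.
(* With this n, N exceeds q 1 / (q x - q 1), hence (1 + 1 / N) q 1 < q x, contradicting [key]. *)
have := key (Num.truncn (q 1 / (q x - q 1))).
rewrite leNgt => /negP; apply.
set n := Num.truncn _; rewrite mulrDl mul1r -ltrBrDl mulrC ltr_pdivrMr ?ltr0n //.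
rewrite mulrC -ltr_pdivrMr //; apply: lt_le_trans (truncnS_gt _) _.
by rewrite ler_nat ltnS leq_addr.
Qed.

Lemma gamma_like_proportional f g x : gamma_like f -> gamma_like g -> 0 < x ->
  f x * g 1 = f 1 * g x.
Proof.
move=> Hf Hg x0; have [f0 _ _] := Hf; have [g0 _ _] := Hg.
have := gamma_like_le Hf Hg x0; have := gamma_like_le Hg Hf x0.
rewrite !ler_pdivrMr ?f0 ?g0 // ![_ / _ * _]mulrAC !ler_pdivlMr ?f0 ?g0 //.
move=> h1 h2; apply/eqP; rewrite eq_le h2 /=.
by rewrite mulrC (mulrC (f x)).
Qed.

End bohr_mollerup.

(** * Positivity, and the relation between beta and Gamma *)

Section beta_gamma.
Variable R : realType.
Local Notation mu := (@lebesgue_measure R).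
Implicit Types (a b s x : R).

Let in0y (t : R) : `]0, +oo[%classic t -> 0 < t.
Proof. by rewrite /= in_itv /= andbT. Qed.

Let m0y : measurable (`]0, +oo[%classic : set (measurableTypeR R)).
Proof. exact: measurable_itv. Qed.

Let m01 : measurable (`]0, 1[%classic : set (measurableTypeR R)).
Proof. exact: measurable_itv. Qed.

Let in01 (t : R) : `]0, 1[%classic t -> 0 < t < 1.
Proof. by rewrite /= in_itv. Qed.

Lemma Gamma_gt0 s : 0 < s -> 0 < Gamma s.
Proof.
move=> s0; have i := gamma_kernel_integrable s0.
have [e j] := integral_powR01 s0.
have sub : (`]0, 1[%classic : set R) `<=` (`]0, +oo[%classic : set R).
  by move=> t /in01 /andP[t0 _]; rewrite /= in_itv /= t0.
have k0 (t : R) : `]0, +oo[%classic t -> 0 <= gamma_kernel s t.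
  by move=> _; exact: gamma_kernel_ge0.
have h := le_Rintegral_subset m01 m0y sub k0 i.
have j' : mu.-integrable `]0, 1[ (EFin \o (fun t => expR (-1) * t `^ (s - 1))).
  by have := integrableZl m01 (expR (-1)) j; exact.
apply: lt_le_trans h; apply: (@lt_le_trans _ _ (expR (-1) * s^-1)).
  by rewrite mulr_gt0 ?expR_gt0 ?invr_gt0.
rewrite -e -(RintegralZl _ m01 j).
apply: (le_Rintegral m01 j' (integrableS m0y m01 sub i)) => t /in01 /andP[t0 t1].
by rewrite mulrC ler_wpM2l ?powR_ge0 // ler_expR lerN2 ltW.
Qed.

Lemma inc_beta_ge0 a b x : 0 <= inc_beta x a b.
Proof. by apply: Rintegral_ge0 => t _; exact: beta_kernel_ge0. Qed.

Lemma inc_beta_le a b x y : 0 < a -> 0 < b -> x <= y -> y <= 1 ->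
  inc_beta x a b <= inc_beta y a b.
Proof.
move=> a0 b0 xy y1.
apply: (@le_Rintegral_subset R `]0, x[%classic `]0, y[%classic (beta_kernel a b)).
- exact: measurable_itv.
- exact: measurable_itv.
- by move=> t /=; rewrite !in_itv /= => /andP[-> h] /=; exact: lt_le_trans xy.
- by move=> t _; exact: beta_kernel_ge0.
- exact: beta_kernel_integrable.
Qed.

(** For x < 1 positivity is read off the boundary term of [inc_beta_rec]. This term vanishes at x =
    1, which is handled by monotonicity from x / 2. *)
Lemma inc_beta_gt0 a b x : 0 < a -> 0 < b -> 0 < x -> x <= 1 -> 0 < inc_beta x a b.
Proof.
move=> a0 b0; wlog x1 : x / x < 1.
  move=> W x0 x1; apply: (@lt_le_trans _ _ (inc_beta (x / 2) a b)).
    by apply: W; lra.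
  by apply: inc_beta_le => //; lra.
move=> x0 _; have x01 : 0 < x <= 1 by rewrite x0 ltW.
rewrite -(pmulr_rgt0 _ a0) (inc_beta_rec a0 b0 x01).
apply: ltr_wpDr; first by rewrite mulr_ge0 ?inc_beta_ge0 // addr_ge0 // ltW.
by rewrite mulr_gt0 // powR_gt0 // subr_gt0.
Qed.

Lemma beta_rec a b : 0 < a -> 0 < b ->
  a * inc_beta 1 a b = (a + b) * inc_beta 1 (a + 1) b.
Proof.
move=> a0 b0; have x01 : 0 < (1 : R) <= 1 by rewrite ltr01 lexx.
by rewrite (inc_beta_rec a0 b0 x01) subrr powR0 ?gt_eqF // mulr0 add0r.
Qed.

Lemma beta1 b : 0 < b -> inc_beta 1 1 b = b^-1.
Proof.
move=> b0; have [<- _] := integral_onem_powR01 b0.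
by apply: eq_Rintegral => t _; rewrite subrr powRr0 mul1r.
Qed.

Lemma Gamma_mellin s : Gamma s = mellin `]0, +oo[%classic (fun t => expR (- t)) s.
Proof. by []. Qed.

Lemma beta_mellin a b :
  inc_beta 1 a b = mellin `]0, 1[%classic (fun t => (1 - t) `^ (b - 1)) a.
Proof. by []. Qed.

Lemma Gamma_interpolation s d h : 0 <= h <= 1 -> 0 < s -> 0 <= d ->
  Gamma (s + h * d) <= (Gamma (s + d) / Gamma s) `^ h * Gamma s.
Proof.
move=> h01 s0 d0; have /andP[h0 h1] := h01.
have hd0 : 0 <= h * d by exact: mulr_ge0.
have G s' : 0 < s' -> mu.-integrable `]0, +oo[ (EFin \o (fun t => t `^ (s' - 1) * expR (- t))).
  exact: gamma_kernel_integrable.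
rewrite !Gamma_mellin; apply: mellin_interpolation => //.
- exact: G.
- by apply: G; rewrite ltr_wpDr.
- by apply: G; rewrite ltr_wpDr.
- by rewrite -Gamma_mellin Gamma_gt0.
- by rewrite -Gamma_mellin Gamma_gt0 // ltr_wpDr.
Qed.

Lemma beta_interpolation a b d h : 0 <= h <= 1 -> 0 < a -> 0 < b -> 0 <= d ->
  inc_beta 1 (a + h * d) b <=
  (inc_beta 1 (a + d) b / inc_beta 1 a b) `^ h * inc_beta 1 a b.
Proof.
move=> h01 a0 b0 d0; have /andP[h0 h1] := h01.
have hd0 : 0 <= h * d by exact: mulr_ge0.
have G a' : 0 < a' ->
    mu.-integrable `]0, 1[ (EFin \o (fun t => t `^ (a' - 1) * (1 - t) `^ (b - 1))).
  by move=> a'0; exact: beta_kernel_integrable.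
rewrite !beta_mellin; apply: mellin_interpolation => //.
- by move=> t /in01 /andP[].
- by move=> t _; exact: powR_ge0.
- exact: G.
- by apply: G; rewrite ltr_wpDr.
- by apply: G; rewrite ltr_wpDr.
- by rewrite -beta_mellin inc_beta_gt0.
- by rewrite -beta_mellin inc_beta_gt0 // ltr_wpDr.
Qed.

Lemma gamma_like_Gamma : gamma_like (@Gamma R).
Proof.
split; [exact: Gamma_gt0 | exact: GammaS |].
move=> x h x0 h01; have := Gamma_interpolation h01 x0 ler01.
by rewrite mulr1 GammaS // mulfK ?gt_eqF ?Gamma_gt0.
Qed.

(** The factors a + b from the two recurrences cancel. In the third clause B contributes (x / (x +
    b))^h and G contributes (x + b)^h, whose product is x^h. *)
Lemma gamma_like_shiftM (B G : R -> R) b : 0 < b -> gamma_like G ->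
  (forall a, 0 < a -> 0 < B a) ->
  (forall a, 0 < a -> a * B a = (a + b) * B (a + 1)) ->
  (forall a h, 0 < a -> 0 <= h <= 1 -> B (a + h) <= (B (a + 1) / B a) `^ h * B a) ->
  gamma_like (fun a => B a * G (a + b)).
Proof.
move=> b0 [G0 GS Gh] B0 BS Bh; split=> [x x0|x x0|x h x0 h01].
- by rewrite mulr_gt0 ?B0 ?G0 // addr_gt0.
- rewrite mulrA BS // addrAC GS ?addr_gt0 //; ring.
- have xb0 : 0 < x + b by rewrite addr_gt0.
  have xh0 : 0 < x + h by rewrite ltr_wpDr //; case/andP: h01.
  have h1 := Bh _ _ x0 h01; have h2 := Gh _ _ xb0 h01.
  have e : B (x + 1) / B x = x / (x + b).
    have -> : B (x + 1) = x * B x / (x + b).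
      by rewrite BS // mulrAC divff ?mul1r // gt_eqF.
    by field; rewrite !gt_eqF ?B0.
  rewrite e in h1; rewrite addrAC in h2.
  have B1 : 0 <= B (x + h) by rewrite ltW ?B0.
  have G1 : 0 <= G (x + h + b) by rewrite ltW ?G0 // addr_gt0.
  apply: (le_trans (ler_pM B1 G1 h1 h2)).
  rewrite le_eqVlt; apply/orP; left; apply/eqP.
  rewrite mulrACA; congr (_ * _).
  by rewrite -powRM ?divr_ge0 ?ltW // divfK // gt_eqF.
Qed.

Lemma gamma_like_betaM b : 0 < b ->
  gamma_like (fun a => inc_beta 1 a b * Gamma (a + b)).
Proof.
move=> b0; apply: (@gamma_like_shiftM (fun a => inc_beta 1 a b) _ _ b0 gamma_like_Gamma).
- by move=> a a0; exact: inc_beta_gt0.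
- by move=> a a0; exact: beta_rec.
- move=> a h a0 h01; have := beta_interpolation h01 a0 b0 ler01.
  by rewrite mulr1; exact.
Qed.

(** The proportionality constant is found at a = 1, where B(1, b) Gamma(b + 1) = Gamma(b). *)
Lemma beta_Gamma a b : 0 < a -> 0 < b ->
  inc_beta 1 a b = Gamma a * Gamma b / Gamma (a + b).
Proof.
move=> a0 b0; have Gab : 0 < Gamma (a + b) by apply: Gamma_gt0; exact: addr_gt0.
have e := gamma_like_proportional (gamma_like_betaM b0) gamma_like_Gamma a0.
have {}e : inc_beta 1 a b * Gamma (a + b) * Gamma 1
  = inc_beta 1 1 b * Gamma (b + 1) * Gamma a by rewrite (addrC b 1).
move: e; rewrite Gamma1 (beta1 b0) (GammaS b0).
move: (inc_beta 1 a b) (Gamma (a + b)) Gab (Gamma a) (Gamma b) => B G G0 A C.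
rewrite mulr1 mulrA mulVf ?gt_eqF // mul1r => e.
by apply: (@canRL _ _ _ _ _ _ (mulfK (lt0r_neq0 G0))); rewrite e mulrC.
Qed.

End beta_gamma.

(** * Series expansion of the normalized incomplete beta function *)

Section reg_inc_beta_series.
Variables (R : realType) (b : R).
Hypothesis b0 : 0 < b.
Implicit Types (u x y : R).

Definition beta_coef u : R := (u * inc_beta 1 u b)^-1.

Lemma beta_coef_gt0 u : 0 < u -> 0 < beta_coef u.
Proof.
move=> u0; have B0 := inc_beta_gt0 u0 b0 ltr01 (lexx 1).
by rewrite invr_gt0; exact: mulr_gt0.
Qed.

Lemma beta_coefE u : 0 < u ->
  beta_coef u = Gamma (u + b) / (Gamma b * Gamma (u + 1)).
Proof.
move=> u0; have ub0 : 0 < u + b by exact: addr_gt0.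
rewrite /beta_coef (beta_Gamma u0 b0) (GammaS u0).
move: (Gamma_gt0 u0) (Gamma_gt0 b0) (Gamma_gt0 ub0).
move: (Gamma u) (Gamma b) (Gamma (u + b)) => A B C A0 B0 C0.
by field; rewrite !gt_eqF.
Qed.

Lemma beta_coefS u : 0 < u -> beta_coef (u + 1) = beta_coef u * ((u + b) / (u + 1)).
Proof.
move=> u0; have ub0 : 0 < u + b by exact: addr_gt0.
have u10 : 0 < u + 1 by exact: addr_gt0.
have B0 := inc_beta_gt0 u10 b0 ltr01 (lexx 1).
rewrite /beta_coef (beta_rec u0 b0); move: (inc_beta _ _ _) B0 => B B0.
by field; rewrite !gt_eqF.
Qed.

Lemma beta_coef_addn u n : 0 < u ->
  beta_coef (u + n%:R) = beta_coef u * (pochhammer (u + b) n / pochhammer (u + 1) n).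
Proof.
move=> u0; elim: n => [|n IH].
  by rewrite /pochhammer !big_ord0 addr0 divff ?mulr1 ?oner_neq0.
have un0 : 0 < u + n%:R by rewrite ltr_wpDr.
rewrite -natr1 addrA beta_coefS // IH /pochhammer !big_ord_recr /=.
rewrite -mulf_div -!mulrA; congr (_ * (_ * (_ * _))).
by congr (_ * _^-1); ring.
Qed.

Lemma reg_inc_beta_rec u x : 0 < u -> 0 < x < 1 ->
  reg_inc_beta x u b = x `^ u * (1 - x) `^ b * beta_coef u + reg_inc_beta x (u + 1) b.
Proof.
move=> u0 /andP[x0 x1]; have x01 : 0 < x <= 1 by rewrite x0 ltW.
have ub0 : 0 < u + b by exact: addr_gt0.
have u10 : 0 < u + 1 by exact: addr_gt0.
have := inc_beta_rec u0 b0 x01; have := beta_rec u0 b0.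
have := inc_beta_gt0 u0 b0 ltr01 (lexx 1).
have := inc_beta_gt0 u10 b0 ltr01 (lexx 1).
rewrite /reg_inc_beta /beta_coef.
move: (inc_beta 1 u b) (inc_beta 1 (u + 1) b) (inc_beta x u b) (inc_beta x (u + 1) b).
move=> B B' I I' B'0 B0 e1 e2.
have -> : I = (x `^ u * (1 - x) `^ b + (u + b) * I') / u.
  by rewrite -e2 mulrAC divff ?mul1r // gt_eqF.
rewrite mulrDl [in LHS]mulrDl -mulrA -invfM; congr (_ + _).
rewrite -mulrA -invfM e1.
by field; rewrite !gt_eqF.
Qed.

Lemma reg_inc_beta_ge0 u x : 0 <= reg_inc_beta x u b.
Proof. by apply: divr_ge0; exact: inc_beta_ge0. Qed.

Lemma partial_sum_of_rec (F c : R -> R) (P : R) u x N : 0 < u -> 0 < x ->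
  (forall v, 0 < v -> F v = x `^ v * P * c v + F (v + 1)) ->
  F u = x `^ u * P * pseries (fun n => c (u + n%:R)) x N + F (u + N%:R).
Proof.
move=> u0 x0 FS; rewrite /pseries /series /=; elim: N => [|N IH].
  by rewrite big_geq // mulr0 add0r addr0.
rewrite IH big_nat_recr //= mulrDr -addrA; congr (_ + _).
rewrite FS; last by rewrite ltr_wpDr.
rewrite -natr1 addrA; congr (_ + _).
have xn0 : x != 0 by rewrite gt_eqF.
rewrite powRD ?xn0 ?implybT // powR_mulrn ?ltW //.
by ring.
Qed.

Lemma reg_inc_beta_partial_sum u x N : 0 < u -> 0 < x < 1 ->
  reg_inc_beta x u b = x `^ u * (1 - x) `^ b
    * pseries (fun n => beta_coef (u + n%:R)) x N + reg_inc_beta x (u + N%:R) b.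
Proof.
move=> u0 x01; have /andP[x0 _] := x01.
apply: (partial_sum_of_rec (F := fun u => reg_inc_beta x u b) N u0 x0) => v v0.
exact: reg_inc_beta_rec.
Qed.

(** Each of the first n terms of the geometric series is at least s^n. *)
Lemma natM_expr_le (s : R) n : 0 < s < 1 -> n%:R * s ^+ n <= (1 - s)^-1.
Proof.
move=> /andP[s0 s1]; have s10 : 0 < 1 - s by rewrite subr_gt0.
rewrite -[leRHS]mul1r ler_pdivlMr //.
have -> : n%:R * s ^+ n * (1 - s) = (1 - s) * \sum_(i < n) s ^+ n.
  by rewrite sumr_const card_ord -[s ^+ n *+ n]mulr_natl mulrC.
apply: (@le_trans _ _ ((1 - s) * \sum_(i < n) s ^+ i)).
  apply: ler_wpM2l; first exact: ltW.
  apply: ler_sum => i _.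
  by apply: ler_wiXn2l; [exact: ltW|exact: ltW|exact: ltnW].
by rewrite -opprB mulNr -subrX1 opprB gerBl exprn_ge0 // ltW.
Qed.

Lemma inc_beta_addn_le u x n : 0 < u -> 0 < x < 1 ->
  inc_beta x (u + n%:R) b <= x ^+ n * inc_beta x u b.
Proof.
move=> u0 /andP[x0 x1]; have x1' := ltW x1.
have un0 : 0 < u + n%:R by rewrite ltr_wpDr.
have m : measurable (`]0, x[%classic : set (measurableTypeR R)) by exact: measurable_itv.
have i1 := beta_kernel_integrable u0 b0 x1'.
have i2 := beta_kernel_integrable un0 b0 x1'.
have i3 : (@lebesgue_measure R).-integrable `]0, x[ (EFin \o (fun t => x ^+ n * beta_kernel u b t)).
  by have h := integrableZl m (x ^+ n) i1; exact: h.
have e := RintegralZl (x ^+ n) m i1.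
rewrite [leRHS](_ : _ = \int[@lebesgue_measure R]_(t in `]0, x[) (x ^+ n * beta_kernel u b t)) //.
apply: (le_Rintegral m i2 i3) => t /=; rewrite in_itv /= => /andP[t0 tx].
have tn0 : t != 0 by rewrite gt_eqF.
have e1 : t `^ (u + n%:R - 1) = t ^+ n * t `^ (u - 1).
  have -> : u + n%:R - 1 = n%:R + (u - 1) by ring.
  by rewrite (@powRD _ t n%:R) ?tn0 ?implybT // powR_mulrn // ltW.
rewrite /beta_kernel e1 -mulrA; apply: ler_wpM2r.
  by rewrite mulr_ge0 ?powR_ge0.
by apply: lerXn2r; rewrite ?nnegrE ltW.
Qed.

(** I_x(u + n, b) is (u + n) g(u + n) times an integral of size O(x^n), so g(u + n) must grow more
    slowly than x^(-n). The point y in ]x, 1[ provides this: g(u + n) = O(y^(-n)). *)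
Lemma reg_inc_beta_addn_cvg0 u x : 0 < u -> 0 < x < 1 ->
  reg_inc_beta x (u + n%:R) b @[n --> \oo] --> (0 : R).
Proof.
move=> u0 x01; have /andP[x0 x1] := x01.
pose y := (1 + x) / 2; have y01 : 0 < y < 1 by rewrite /y; apply/andP; split; lra.
have /andP[y0 y1] := y01; have xy : x < y by rewrite /y; lra.
pose r := x / y; have r0 : 0 < r by rewrite divr_gt0.
have r1 : r < 1 by rewrite ltr_pdivrMr // mul1r.
(* The ratio r = x / y is split as s q with both factors below 1: s^n absorbs the linear factor u +
   n, and q^n gives the decay. *)
pose s := (1 + r) / 2; have s01 : 0 < s < 1 by rewrite /s; apply/andP; split; lra.
have /andP[s0 s1] := s01; have rs : r < s by rewrite /s; lra.
pose q := r / s; have q0 : 0 < q by rewrite divr_gt0.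
have q1 : q < 1 by rewrite ltr_pdivrMr // mul1r.
pose P := y `^ u * (1 - y) `^ b.
have P0 : 0 < P by rewrite mulr_gt0 // powR_gt0 // subr_gt0.
pose K := reg_inc_beta y u b / P.
(* The left side is one term of a partial sum at y; the other terms and the remainder are
   nonnegative. *)
have bound n : beta_coef (u + n%:R) * y ^+ n <= K.
  have un0 : 0 < u + n%:R by rewrite ltr_wpDr.
  rewrite ler_pdivlMr // (reg_inc_beta_partial_sum n.+1 u0 y01) -/P.
  apply: ler_wpDr; first exact: reg_inc_beta_ge0.
  rewrite mulrC ler_pM2l // /pseries /series /= big_nat_recr //=.
  apply: ler_wpDl => //; apply: sumr_ge0 => i _.
  by rewrite mulr_ge0 ?exprn_ge0 ?ltW // beta_coef_gt0 // ltr_wpDr.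
pose C := K * inc_beta x u b * (u + (1 - s)^-1).
have K0 : 0 <= K by rewrite divr_ge0 ?reg_inc_beta_ge0 // ltW.
have le n : reg_inc_beta x (u + n%:R) b <= C * q ^+ n.
  have un0 : 0 < u + n%:R by rewrite ltr_wpDr.
  have g0 := beta_coef_gt0 un0.
  have -> : reg_inc_beta x (u + n%:R) b =
      (u + n%:R) * beta_coef (u + n%:R) * inc_beta x (u + n%:R) b.
    have := inc_beta_gt0 un0 b0 ltr01 (lexx 1).
    rewrite /reg_inc_beta /beta_coef.
    move: (inc_beta 1 _ _) (inc_beta x _ _) => B I B0.
    by field; rewrite !gt_eqF.
  apply: (@le_trans _ _ ((u + n%:R) * beta_coef (u + n%:R) * (x ^+ n * inc_beta x u b))).
    by apply: ler_wpM2l (inc_beta_addn_le n u0 x01); rewrite mulr_ge0 // ltW.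
  have -> : x ^+ n = y ^+ n * (s ^+ n * q ^+ n).
    by rewrite -!exprMn; congr (_ ^+ _); rewrite /q /r; field; rewrite !gt_eqF.
  have I0 := inc_beta_ge0 u b x.
  rewrite /C; move: (inc_beta x u b) I0 => I I0.
  rewrite [leLHS](_ : _ = (beta_coef (u + n%:R) * y ^+ n) * I * ((u + n%:R) * s ^+ n) * q ^+ n); last ring.
  apply: ler_wpM2r; first by rewrite exprn_ge0 // ltW.
  apply: ler_pM => //.
  - by rewrite !mulr_ge0 ?exprn_ge0 // ltW.
  - by rewrite mulr_ge0 ?exprn_ge0 // ltW.
  - by rewrite ler_wpM2r.
  - rewrite mulrDl; apply: lerD (natM_expr_le n s01).
    by rewrite ler_piMr ?exprn_ile1 // ltW.
have c : C * q ^+ n @[n --> \oo] --> (0 : R).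
  by apply: cvg_geometric; rewrite gtr0_norm.
apply: (squeeze_cvgr _ (cvg_cst 0) c); apply: nearW => n.
by rewrite reg_inc_beta_ge0 le.
Qed.

Lemma reg_inc_beta_series u x : 0 < u -> 0 < x < 1 ->
  pseries (fun n => beta_coef (u + n%:R)) x @ \oo -->
  reg_inc_beta x u b / (x `^ u * (1 - x) `^ b).
Proof.
move=> u0 x01; have /andP[x0 x1] := x01.
pose P := x `^ u * (1 - x) `^ b.
have P0 : 0 < P by rewrite mulr_gt0 // powR_gt0 // subr_gt0.
rewrite [X in X @ _](_ : _ = fun n => (reg_inc_beta x u b - reg_inc_beta x (u + n%:R) b) * P^-1).
  rewrite -[reg_inc_beta x u b in X in _ --> X]subr0.
  apply: cvgM; last exact: cvg_cst.
  by apply: cvgB; [exact: cvg_cst | exact: reg_inc_beta_addn_cvg0].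
apply/funext => n; rewrite (reg_inc_beta_partial_sum n u0 x01) addrK -/P.
by rewrite mulrC mulKf // gt_eqF.
Qed.

End reg_inc_beta_series.

(** * Uniqueness of coefficients and Cauchy products *)

Section power_series.
Variable R : realType.
Implicit Types (u v e : nat -> R) (x : R).

Lemma pseriesS e x n :
  pseries e x n.+1 = e 0%N + x * pseries (fun k => e k.+1) x n.
Proof.
rewrite /pseries /series /= big_nat_recl // expr0 mulr1 mulr_sumr; congr (_ + _).
by apply: eq_bigr => i _; rewrite exprS mulrCA.
Qed.

Lemma pseriesB u v x :
  pseries (fun k => u k - v k) x = fun n => pseries u x n - pseries v x n.
Proof.
apply/funext => n; rewrite /pseries /series /= -sumrB; apply: eq_bigr => i _.
by rewrite mulrBl.
Qed.

Lemma sum_half_le n : \sum_(0 <= i < n) (2^-1 : R) ^+ i <= 2.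
Proof.
rewrite big_mkord; have := subrX1 (2^-1 : R) n.
have : 0 <= (2^-1 : R) ^+ n by rewrite exprn_ge0 // invr_ge0.
move: (\sum_(i < n) _) (_ ^+ n) => S p p0 e.
have e2 : 2^-1 - 1 = - 2^-1 :> R by lra.
rewrite e2 in e.
lra.
Qed.

Lemma pseries_eq0_head e :
  (forall x, 0 < x < 1 -> pseries e x @ \oo --> (0 : R)) -> e 0%N = 0.
Proof.
move=> He; apply/eqP; apply: contraT => e0.
have h12 : 0 < (2^-1 : R) < 1 by apply/andP; split; lra.
have /cvgP/cvg_series_cvg_0/cvgP/cvg_seq_bounded := He _ h12.
move=> -[M [_ HM]]; pose K := `|M| + 1.
have K0 : 0 < K by rewrite ltr_wpDl.
have bound n : `|e n| * 2^-1 ^+ n <= K.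
  have MK : M < K by rewrite /K; have := ler_norm M; lra.
  have p0 : 0 <= (2^-1 : R) ^+ n by rewrite exprn_ge0 // invr_ge0.
  by have := HM _ MK n I; rewrite /= normrM (ger0_norm p0).
have e0' : 0 < `|e 0%N| by rewrite normr_gt0.
(* The bound 1/4 is half of 1/2, where the terms are bounded by K, so the tail is dominated by 2 K
   times a geometric series of ratio 1/2, at most 4 K. The second bound makes x times the tail at
   most half of |e 0|, so the partial sums stay away from 0. *)
pose x := Num.min 4^-1 (`|e 0%N| / (8 * K)).
have x0 : 0 < x.
  by rewrite lt_min; apply/andP; split; [lra | rewrite divr_gt0 // mulr_gt0].
have x4 : x <= 4^-1 by rewrite ge_min lexx.
have xe : x * (8 * K) <= `|e 0%N|.
  by rewrite -ler_pdivlMr ?mulr_gt0 // ge_min lexx orbT.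
have tail n : `|pseries (fun k => e k.+1) x n| <= 4 * K.
  apply: (le_trans (ler_norm_sum _ _ _)).
  apply: (@le_trans _ _ (\sum_(0 <= i < n) (2 * K) * 2^-1 ^+ i)); last first.
    rewrite -mulr_sumr; have := sum_half_le n; move: (\sum_(0 <= i < n) _) => S S2.
    have hh : 0 <= K * (2 - S) by apply: mulr_ge0; lra.
    by lra.
  apply: ler_sum => i _; have p0 : 0 <= x ^+ i by rewrite exprn_ge0 // ltW.
  rewrite normrM (ger0_norm p0).
  have b := bound i.+1; have h : x ^+ i <= 4^-1 ^+ i.
    by apply: lerXn2r => //; rewrite nnegrE ?invr_ge0 // ltW.
  apply: (le_trans (ler_wpM2l (normr_ge0 _) h)).
  have -> : 4^-1 = 2^-1 * 2^-1 :> R by rewrite -invfM; congr _^-1; ring.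
  rewrite exprMn mulrA ler_wpM2r ?exprn_ge0 ?invr_ge0 //.
  rewrite exprS in b; move: b; rewrite mulrCA; lra.
have x01 : 0 < x < 1 by rewrite x0 /=; lra.
have half : 0 < `|e 0%N| / 2 by lra.
have /cvgrPdist_lt/(_ _ half)[N _ /(_ N.+1 (leqnSn N))] := He _ x01.
rewrite /= sub0r normrN pseriesS.
have := ler_normB (e 0%N + x * pseries (fun k => e k.+1) x N) (x * pseries (fun k => e k.+1) x N).
rewrite addrK normrM (gtr0_norm x0).
have := ler_wpM2l (ltW x0) (tail N).
by move=> *; lra.
Qed.

Lemma pseries_eq0 e :
  (forall x, 0 < x < 1 -> pseries e x @ \oo --> (0 : R)) -> forall k, e k = 0.
Proof.
move=> He k; elim: k e He => [|k IH] e He; first exact: pseries_eq0_head.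
apply: (IH (fun k => e k.+1)) => x x01; have /andP[x0 _] := x01.
have e0 := pseries_eq0_head He.
have -> : pseries (fun k => e k.+1) x = fun n => x^-1 * pseries e x n.+1.
  by apply/funext => n; rewrite pseriesS e0 add0r mulKf // gt_eqF.
rewrite -(mulr0 x^-1); apply: cvgM; first exact: cvg_cst.
by have := He _ x01; rewrite -cvg_shiftS.
Qed.

Definition cauchy_prod u v n : R := \sum_(0 <= i < n.+1) u i * v (n - i)%N.

(** The triangle of indices with i + j < n is summed row by row. *)
Lemma series_cauchy_prod u v n :
  series (cauchy_prod u v) n = \sum_(0 <= i < n) u i * series v (n - i)%N.
Proof.
rewrite {1}/series /=; elim: n => [|n IH]; first by rewrite !big_geq.
have sS k : series v k.+1 = series v k + v k by rewrite /series /= big_nat_recr.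
rewrite !big_nat_recr //= IH /cauchy_prod big_nat_recr //= subnn subSnn sS.
have s0 : series v 0%N = 0 by rewrite /series /= big_geq.
rewrite s0 add0r addrA; congr (_ + _).
rewrite -big_split /=; apply: eq_big_nat => i /andP[_ ltin].
by rewrite -mulrDr -sS subSn // ltnW.
Qed.

(** For nonnegative terms the triangular sums are squeezed: the square i, j < n lies in the triangle
    i + j < 2 n, and every triangular sum is at most U V. *)
Lemma cvg_cauchy_prod u v (U V : R) : (forall n, 0 <= u n) -> (forall n, 0 <= v n) ->
  series u @ \oo --> U -> series v @ \oo --> V ->
  series (cauchy_prod u v) @ \oo --> U * V.
Proof.
move=> u0 v0 cu cv.
have nd w : (forall n, 0 <= w n) -> nondecreasing_seq (series w : nat -> R).
  by move=> w0; apply/nondecreasing_seqP => n; rewrite /series /= big_nat_recr //= lerDl.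
have ge0 w n : (forall n, 0 <= w n) -> 0 <= (series w n : R).
  by move=> w0; apply: sumr_ge0.
have leU n : series u n <= U.
  rewrite -(cvg_lim _ cu) //; apply: nondecreasing_cvgn_le; first exact: nd.
  by apply: cvgP cu.
have leV n : series v n <= V.
  rewrite -(cvg_lim _ cv) //; apply: nondecreasing_cvgn_le; first exact: nd.
  by apply: cvgP cv.
have c0 n : 0 <= cauchy_prod u v n by apply: sumr_ge0 => i _; rewrite mulr_ge0.
have up n : series (cauchy_prod u v) n <= U * V.
  rewrite series_cauchy_prod; apply: (@le_trans _ _ (series u n * V)).
    by rewrite [series u n]/series /= mulr_suml; apply: ler_sum => i _; apply: ler_wpM2l; rewrite ?leV.
  by apply: ler_wpM2r => //; apply: le_trans (leV 0%N); exact: ge0.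
have low n : series u n * series v n <= series (cauchy_prod u v) (n + n).
  rewrite series_cauchy_prod (big_cat_nat (n := n)) ?leq_addr //=.
  apply: ler_wpDr; first by apply: sumr_ge0 => i _; rewrite mulr_ge0 ?ge0.
  rewrite [series u n]/series /= mulr_suml; apply: ler_sum_nat => i /andP[_ ltin].
  by apply: ler_wpM2l => //; apply: nd => //; rewrite -addnBA ?leq_addr // ltnW.
have cc : cvgn (series (cauchy_prod u v)).
  by apply: nondecreasing_is_cvgn; [exact: nd | exists (U * V) => _ [n _ <-]].
suff -> : U * V = limn (series (cauchy_prod u v)) by [].
apply/eqP; rewrite eq_le; apply/andP; split; last first.
  by apply: limr_le => //; exact: nearW.
have cuv : (fun n => series u n * series v n) @ \oo --> U * V by exact: cvgM.
rewrite -(cvg_lim _ cuv) //; apply: limr_le; first exact: cvgP cuv.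
apply: nearW => n; apply: le_trans (low n) _.
by apply: nondecreasing_cvgn_le => //; exact: nd.
Qed.

Lemma pseries_cauchy_prod u v x (U V : R) : 0 <= x ->
  (forall n, 0 <= u n) -> (forall n, 0 <= v n) ->
  pseries u x @ \oo --> U -> pseries v x @ \oo --> V ->
  pseries (cauchy_prod u v) x @ \oo --> U * V.
Proof.
move=> x0 u0 v0 cu cv.
have := cvg_cauchy_prod _ _ cu cv.
rewrite /pseries (_ : cauchy_prod (fun i => u i * x ^+ i) _ =
    fun i => cauchy_prod u v i * x ^+ i).
  by apply=> n; rewrite mulr_ge0 // exprn_ge0.
apply/funext => n; rewrite /cauchy_prod mulr_suml; apply: eq_big_nat => i /andP[_ lein].
by rewrite mulrACA -exprD subnKC.
Qed.

End power_series.

(** * Strict log-convexity and the sign of paired terms *)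

Section log_convexity.
Variable R : realType.
Implicit Types (x h l d : R).

(** For positive g: the increments of ln g over a fixed step increase strictly. This four-point form
    compares the kind of products that occur in psi_k. *)
Definition strictly_log_convex (g : R -> R) :=
  forall x h l, 0 < x -> 0 < h -> 0 < l -> g (x + h) * g (x + l) < g x * g (x + h + l).

(** The points x + h and x + l divide [x, x + h + l] in complementary proportions, so the two
    interpolation exponents add up to 1. *)
Lemma interpolation_log_convex (f : R -> R) x h l :
  (forall u, 0 < u -> 0 < f u) ->
  (forall u d t, 0 <= t <= 1 -> 0 < u -> 0 <= d ->
    f (u + t * d) <= (f (u + d) / f u) `^ t * f u) ->
  0 < x -> 0 < h -> 0 < l -> f (x + h) * f (x + l) <= f x * f (x + h + l).
Proof.
move=> f0 fi x0 h0 l0; pose d := h + l; have d0 : 0 < d by exact: addr_gt0.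
have hl : h / d + l / d = 1 by rewrite -mulrDl divff // gt_eqF.
have hd0 : 0 < h / d by exact: divr_gt0.
have ld0 : 0 < l / d by exact: divr_gt0.
have t1 : 0 <= h / d <= 1 by apply/andP; split; [exact: ltW | rewrite -hl lerDl ltW].
have t2 : 0 <= l / d <= 1 by apply/andP; split; [exact: ltW | rewrite -hl lerDr ltW].
have := fi x d _ t1 x0 (ltW d0); have := fi x d _ t2 x0 (ltW d0).
rewrite !divfK ?gt_eqF // => i2 i1.
have fx := f0 _ x0; have fxd : 0 < f (x + d) by rewrite f0 // addr_gt0.
set c := f (x + d) / f x in i1 i2; have c0 : 0 < c by exact: divr_gt0.
have fh : 0 <= f (x + h) by rewrite ltW // f0 // addr_gt0.
have fl : 0 <= f (x + l) by rewrite ltW // f0 // addr_gt0.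
apply: (le_trans (ler_pM fh fl i1 i2)).
rewrite mulrACA -powRD; last by rewrite (gt_eqF c0) implybT.
rewrite hl powRr1; last exact: ltW.
rewrite -addrA -/d.
by rewrite le_eqVlt; apply/orP; left; apply/eqP; rewrite /c; field; rewrite gt_eqF.
Qed.

(* With P the largest of the four products, P S > Q R gives
   P (P + S - Q - R) > (P - Q) (P - R) >= 0. *)
Lemma log_convex_rearrangement (g : R -> R) x d h l :
  (forall u, 0 < u -> 0 < g u) -> strictly_log_convex g ->
  0 < x -> 0 <= d -> 0 < h -> 0 < l ->
  g (x + h) * g (x + d + l) + g (x + d + h) * g (x + l) <
  g x * g (x + d + h + l) + g (x + d) * g (x + h + l).
Proof.
move=> g0 gc x0 d0 h0 l0.
have xd0 : 0 < x + d by rewrite ltr_wpDr.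
have PQ := gc x h (d + l) x0 h0 (ltr_wpDl d0 l0).
have PR := gc x (d + h) l x0 (ltr_wpDl d0 h0) l0.
have s1 := gc x h l x0 h0 l0; have s2 := gc (x + d) h l xd0 h0 l0.
have e1 : x + (d + l) = x + d + l by ring.
have e2 : x + h + (d + l) = x + d + h + l by ring.
have e3 : x + (d + h) = x + d + h by ring.
rewrite e1 e2 in PQ; rewrite e3 in PR.
have p1 : 0 < g (x + h) * g (x + l) by rewrite mulr_gt0 ?g0 // addr_gt0.
have p2 : 0 < g (x + d + h) * g (x + d + l) by rewrite mulr_gt0 ?g0 // addr_gt0.
have P0 : 0 < g x * g (x + d + h + l) by apply: lt_trans PQ; rewrite mulr_gt0 ?g0 // addr_gt0.
have PS := ltr_pM (ltW p1) (ltW p2) s1 s2.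
rewrite -(ltr_pM2l P0); move: PQ PR PS.
move: (g x) (g (x + h)) (g (x + l)) (g (x + d)) (g (x + h + l)) (g (x + d + h))
  (g (x + d + l)) (g (x + d + h + l)) => A B C D E F G H PQ PR PS.
have : 0 <= (A * H - B * G) * (A * H - F * C) by rewrite mulr_ge0 ?subr_ge0 ?ltW.
by move=> k; lra.
Qed.

(** The rearrangement inequality at p + m with d = n - m. The case m = n is included, for the middle
    term of an even k, which is paired with itself. *)
Lemma log_convex_pair_lt0 (g : R -> R) p h l (m n : nat) :
  (forall u, 0 < u -> 0 < g u) -> strictly_log_convex g ->
  0 < p -> 0 < h -> 0 < l ->
  (g (p + h + m%:R) * g (p + l + n%:R) - g (p + m%:R) * g (p + h + l + n%:R))
  + (g (p + h + n%:R) * g (p + l + m%:R) - g (p + n%:R) * g (p + h + l + m%:R)) < 0.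
Proof.
move=> g0 gc p0 h0 l0; wlog mn : m n / (m <= n)%N.
  move=> W; case: (leqP m n) => [/W //|/ltnW /W].
  by rewrite [X in X < 0 -> _]addrC.
have pm0 : 0 < p + m%:R by rewrite ltr_wpDr.
have := log_convex_rearrangement g0 gc pm0 (ler0n R (n - m)) h0 l0.
rewrite natrB //.
have -> : p + m%:R + (n%:R - m%:R) = p + n%:R by ring.
have e (k : nat) : p + h + l + k%:R = p + k%:R + h + l by ring.
rewrite !e !(addrAC p h) !(addrAC p l).
by move=> k; lra.
Qed.

End log_convexity.

(** * Telescoping for integer shifts *)

Section telescoping.
Variable R : realType.

(* The sums F j with shifts (j, al - j) interpolate between the two Cauchy products;
   F j and F j.+1 are the sums of the same sequence over two consecutive windows. *)
Lemma cauchy_prod_shiftB (g : R -> R) (p q : R) (al k : nat) :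
  cauchy_prod (fun n => g (p + al%:R + n%:R)) (fun n => g (q + n%:R)) k
    - cauchy_prod (fun n => g (p + n%:R)) (fun n => g (q + al%:R + n%:R)) k =
  \sum_(j < al) (g (p + j%:R + k.+1%:R) * g (q + al%:R - 1 - j%:R)
    - g (p + j%:R) * g (q + al%:R - 1 - j%:R + k.+1%:R)).
Proof.
pose w j : R := q + al%:R - 1 - j%:R.
pose F j := \sum_(0 <= m < k.+1) g (p + j%:R + m%:R) * g (w j + 1 + (k - m)%:R).
rewrite [LHS](_ : _ = F al - F 0%N); last first.
  have e1 i : q + i = w al + 1 + i by rewrite /w; ring.
  have e2 i : q + al%:R + i = w 0%N + 1 + i by rewrite /w; ring.
  congr (_ - _); apply: eq_bigr => i _; first by rewrite e1.
  by rewrite e2 addr0.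
rewrite -(telescope_sumr F (leq0n al)) big_mkord; apply: eq_bigr => j _.
pose u m := g (p + j%:R + m%:R) * g (w j + (k.+1 - m)%:R).
have -> : F j = \sum_(0 <= m < k.+1) u m.
  apply: eq_big_nat => m /andP[_ lemk]; rewrite /u subSn // -natr1.
  by rewrite [_ + 1 in RHS]addrC addrA.
have -> : F j.+1 = \sum_(0 <= m < k.+1) u m.+1.
  apply: eq_big_nat => m /andP[_ lemk]; rewrite /u subSS.
  have -> : w j.+1 + 1 = w j by rewrite /w -natr1; ring.
  have -> // : p + j.+1%:R + m%:R = p + j%:R + m.+1%:R by rewrite -!natr1; ring.
by rewrite -sumrB telescope_sumr // /u subnn subn0 !addr0.
Qed.

End telescoping.

(** * The coefficients psi_k and their signs *)

Section turan_coefficients.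
Variables (R : realType) (a b : R).
Hypotheses (a0 : 0 < a) (b0 : 0 < b).
Local Notation g := (beta_coef b).
Implicit Types (al be : R).

Definition turan_coef al be k : R :=
  cauchy_prod (fun n => g (a + al + n%:R)) (fun n => g (a + be + n%:R)) k
  - cauchy_prod (fun n => g (a + n%:R)) (fun n => g (a + al + be + n%:R)) k.

Lemma is_psi_turan_coef al be : 0 < al -> 0 < be -> is_psi a b al be (turan_coef al be).
Proof.
move=> al0 be0 x x01; have /andP[x0 x1] := x01.
have S u := @reg_inc_beta_series R b b0 u x ^~ x01.
have g0 u n : 0 < u -> 0 <= g (u + n%:R).
  by move=> u0; apply/ltW/beta_coef_gt0 => //; rewrite ltr_wpDr.
have aal0 : 0 < a + al by exact: addr_gt0.
have abe0 : 0 < a + be by exact: addr_gt0.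
have aab0 : 0 < a + al + be by exact: addr_gt0.
have c1 := pseries_cauchy_prod (ltW x0) (fun n => g0 _ n aal0) (fun n => g0 _ n abe0)
  (S _ aal0) (S _ abe0).
have c2 := pseries_cauchy_prod (ltW x0) (fun n => g0 _ n a0) (fun n => g0 _ n aab0)
  (S _ a0) (S _ aab0).
have c := cvgB c1 c2.
have {}c : pseries (turan_coef al be) x @ \oo -->
   (reg_inc_beta x (a + al) b / (x `^ (a + al) * (1 - x) `^ b) *
    (reg_inc_beta x (a + be) b / (x `^ (a + be) * (1 - x) `^ b)) -
    reg_inc_beta x a b / (x `^ a * (1 - x) `^ b) *
    (reg_inc_beta x (a + al + be) b / (x `^ (a + al + be) * (1 - x) `^ b))).
  by rewrite pseriesB; exact: c.
split; first exact: cvgP c.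
rewrite (cvg_lim _ c) // /turan_beta.
have xn0 : x != 0 by rewrite gt_eqF.
have s0 : 0 < 1 - x by rewrite subr_gt0.
have sn0 : 1 - x != 0 by rewrite gt_eqF.
have Ps p : 0 < x `^ p by exact: powR_gt0.
have Pb : 0 < (1 - x) `^ b by exact: powR_gt0.
have -> : (1 - x) `^ (2 * b) = (1 - x) `^ b * (1 - x) `^ b.
  by rewrite -powRD ?sn0 ?implybT //; congr (_ `^ _); ring.
have e1 : x `^ (2 * a + al + be) = x `^ (a + al) * x `^ (a + be).
  by rewrite -powRD ?xn0 ?implybT //; congr (_ `^ _); ring.
have e2 : x `^ (2 * a + al + be) = x `^ a * x `^ (a + al + be).
  by rewrite -powRD ?xn0 ?implybT //; congr (_ `^ _); ring.
rewrite mulrBr {1}e1 e2.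
move: (Ps (a + al)) (Ps (a + be)) (Ps a) (Ps (a + al + be)) Pb.
move: (x `^ (a + al)) (x `^ (a + be)) (x `^ a) (x `^ (a + al + be)) ((1 - x) `^ b).
move: (reg_inc_beta x (a + al) b) (reg_inc_beta x (a + be) b) (reg_inc_beta x a b)
  (reg_inc_beta x (a + al + be) b).
move=> I1 I2 I3 I4 p1 p2 p3 p4 q h1 h2 h3 h4 hq.
by congr (_ - _); field; rewrite !gt_eqF.
Qed.

Lemma is_psi_unique al be c c' :
  is_psi a b al be c -> is_psi a b al be c' -> c = c'.
Proof.
move=> Hc Hc'; apply/funext => k; apply/eqP; rewrite -subr_eq0; apply/eqP.
apply: (@pseries_eq0 _ (fun k => c k - c' k)) => x x01.
have [cc ec] := Hc _ x01; have [cc' ec'] := Hc' _ x01; have /andP[x0 x1] := x01.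
have P0 : 0 < x `^ (2 * a + al + be) * (1 - x) `^ (2 * b).
  by rewrite mulr_gt0 // powR_gt0 // subr_gt0.
have e : limn (pseries c x) = limn (pseries c' x).
  by apply: (mulfI (lt0r_neq0 P0)); rewrite -ec -ec'.
by have := cvgB cc cc'; rewrite e subrr pseriesB; exact.
Qed.

Lemma psiE al be : 0 < al -> 0 < be -> psi a b al be = turan_coef al be.
Proof.
move=> al0 be0; have H := is_psi_turan_coef al0 be0.
apply: (@is_psi_unique al be) => //.
exact: (@xgetPex _ (fun=> 0) [set c | is_psi a b al be c] (ex_intro _ _ H)).
Qed.

Let w (al : nat) be j : R := a + be + al%:R - 1 - j%:R.

(** By [beta_coef_addn] this is g(u + k + 1) / g(u). *)
Let rho k u : R := pochhammer (u + b) k.+1 / pochhammer (u + 1) k.+1.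

Let w_gt0 (al : nat) be j : (j < al)%N -> 0 < be -> 0 < w al be j.
Proof.
move=> jal be0; have : j.+1%:R <= al%:R :> R by rewrite ler_nat.
rewrite -natr1 /w => h; have ha := a0; lra.
Qed.

Lemma turan_coef_nat (al : nat) be k : 0 < be ->
  turan_coef al%:R be k =
  \sum_(j < al) g (a + j%:R) * g (w al be j) * (rho k (a + j%:R) - rho k (w al be j)).
Proof.
move=> be0; have gn := @beta_coef_addn _ _ b0.
rewrite /turan_coef (addrAC a) /rho /w; move: g gn => f fn.
rewrite cauchy_prod_shiftB; apply: eq_bigr => j _.
have aj0 : 0 < a + j%:R by rewrite ltr_wpDr.
have wj0 : 0 < a + be + al%:R - 1 - j%:R by exact: w_gt0.
rewrite (fn _ _ aj0) (fn _ _ wj0).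
by move: (f _) (f _) (_ / _) (_ / _) => A B C D; ring.
Qed.

(** Each factor is 1 + (b - 1) / (u + 1 + i), positive and decreasing in u because b > 1. *)
Lemma rho_lt k u v : 1 < b -> 0 < u -> u < v -> rho k v < rho k u.
Proof.
move=> b1 u0 uv; rewrite /rho /pochhammer -!prodf_div.
have v0 := lt_trans u0 uv.
pose r t i := (t + b + i%:R) / (t + 1 + i%:R : R).
have r0 t i : 0 < t -> 0 < r t i.
  by move=> t0; rewrite divr_gt0 // ltr_wpDr // addr_gt0.
have rlt i : r v i < r u i.
  have i0 : 0 <= i%:R :> R by [].
  rewrite /r ltr_pdivrMr; last by lra.
  rewrite mulrAC ltr_pdivlMr; last by lra.
  by move: i0; move: (i%:R) => n n0; nra.
elim: k => [|k IH]; first by rewrite !big_ord1; exact: rlt.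
rewrite big_ord_recr [ltRHS]big_ord_recr /=; apply: ltr_pM => //; last exact: rlt.
- by apply: prodr_ge0 => i _; apply/ltW/r0.
- by apply/ltW/r0.
Qed.

Lemma turan_coef_gt0 (al : nat) be k : 1 < b -> (0 < al)%N -> al%:R - 1 <= be -> 0 < be ->
  0 < turan_coef al%:R be k.
Proof.
move=> b1 al0 albe be0; rewrite turan_coef_nat //.
have lt j : (j < al)%N -> a + j%:R < w al be j ->
  0 < g (a + j%:R) * g (w al be j) * (rho k (a + j%:R) - rho k (w al be j)).
  move=> jal l; have aj0 : 0 < a + j%:R by rewrite ltr_wpDr.
  rewrite mulr_gt0 ?subr_gt0 ?rho_lt // mulr_gt0 // beta_coef_gt0 //; exact: w_gt0.
case: al al0 albe lt => // al _ albe lt.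
(* Here alpha is [al.+1], and the gap between the two arguments of [rho] is be + al - 2 j. It is
   positive at j = 0 since be > 0; for j <= al it is at least be - al >= 0, and the term vanishes
   when the gap is 0. *)
rewrite big_ord_recl; apply: ltr_wpDr; last first.
  apply: lt => //; rewrite /w -natr1 /=.
  by have h : 0 <= al%:R :> R by []; lra.
apply: sumr_ge0 => j _.
have jal : (lift ord0 j < al.+1)%N by exact: ltn_ord.
have : a + (lift ord0 j)%:R <= w al.+1 be (lift ord0 j).
  have h : (lift ord0 j)%:R <= al%:R :> R by rewrite ler_nat -ltnS.
  by move: albe; rewrite /w -natr1 => albe; lra.
rewrite le_eqVlt => /predU1P[<-|l]; last exact/ltW/lt.
by rewrite subrr mulr0.
Qed.

Lemma beta_coef_log_convex : b < 1 -> strictly_log_convex g.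
Proof.
move=> b1; have c0 : 0 < 1 - b by rewrite subr_gt0.
pose f u := inc_beta 1 (u + b) (1 - b).
have f0 u : 0 < u -> 0 < f u by move=> u0; apply: inc_beta_gt0 => //; exact: addr_gt0.
have fi u d t : 0 <= t <= 1 -> 0 < u -> 0 <= d ->
    f (u + t * d) <= (f (u + d) / f u) `^ t * f u.
  move=> t01 u0 d0; rewrite /f !(addrAC u _ b).
  by apply: beta_interpolation => //; exact: addr_gt0.
pose C := (Gamma b * Gamma (1 - b))^-1.
have C0 : 0 < C by rewrite invr_gt0 mulr_gt0 // Gamma_gt0.
have gf u : 0 < u -> g u = C * f u.
  move=> u0; have ub0 : 0 < u + b by exact: addr_gt0.
  have e : u + b + (1 - b) = u + 1 by ring.
  have u10 : 0 < u + 1 by exact: addr_gt0.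
  rewrite beta_coefE // /f beta_Gamma // e /C.
  move: (Gamma_gt0 b0) (Gamma_gt0 c0) (Gamma_gt0 u10).
  move: (Gamma b) (Gamma (1 - b)) (Gamma (u + 1)) (Gamma (u + b)) => A B D E A0 B0 D0.
  by field; rewrite !gt_eqF.
have weak x h l : 0 < x -> 0 < h -> 0 < l -> g (x + h) * g (x + l) <= g x * g (x + h + l).
  move=> x0 h0 l0; have := interpolation_log_convex f0 fi x0 h0 l0.
  have xh0 := addr_gt0 x0 h0; have xl0 := addr_gt0 x0 l0.
  rewrite (gf _ x0) (gf _ xh0) (gf _ xl0) (gf _ (addr_gt0 xh0 l0)).
  move: (f0 _ x0) (f0 _ xh0) (f0 _ xl0) (f0 _ (addr_gt0 xh0 l0)).
  move: (f x) (f (x + h)) (f (x + l)) (f (x + h + l)) => A B D E A0 B0 D0 E0 i.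
  rewrite [leLHS]mulrACA [leRHS]mulrACA; apply: ler_wpM2l i.
  by rewrite mulr_ge0 // ltW.
(* The recurrence for g upgrades the inequality at x + 1 to a strict one at x. *)
move=> x h l x0 h0 l0.
have x10 : 0 < x + 1 by exact: addr_gt0.
have := weak (x + 1) h l x10 h0 l0.
have -> : x + 1 + h + l = x + h + l + 1 by ring.
rewrite !(addrAC x 1) !beta_coefS ?addr_gt0 //.
have := beta_coef_gt0 b0 x0; have := beta_coef_gt0 b0 (addr_gt0 (addr_gt0 x0 h0) l0).
have := beta_coef_gt0 b0 (addr_gt0 x0 h0); have := beta_coef_gt0 b0 (addr_gt0 x0 l0).
move: (g x) (g (x + h)) (g (x + l)) (g (x + h + l)) => A B D E D0 B0 E0 A0.
set r1 := (_ + b) / _; set r2 := (_ + b) / _; set r3 := (_ + b) / _; set r4 := (_ + b) / _.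
rewrite [leLHS]mulrACA [leRHS]mulrACA => le.
(* The ratio (t + b) / (t + 1) of the recurrence is strictly log-concave for b < 1; r3, r4 are its
   values at the outer points x, x + h + l and r1, r2 those at the inner ones. The difference of the
   cross products is h l (1 - b) (1 + b + 2 x + h + l). *)
have r34 : r3 * r4 < r1 * r2.
  rewrite /r1 /r2 /r3 /r4 !mulf_div.
  rewrite ltr_pdivrMr ?mulr_gt0 ?addr_gt0 // mulrAC ltr_pdivlMr ?mulr_gt0 ?addr_gt0 //.
  have hl : 0 < h * l by exact: mulr_gt0.
  have k : 0 < h * l * ((1 - b) * (1 + b + 2 * x + h + l)).
    have hb := b0; rewrite mulr_gt0 // mulr_gt0 //; lra.
  by rewrite -subr_gt0; apply: lt_le_trans k _; rewrite le_eqVlt; apply/orP; left; apply/eqP; ring.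
have r0 : 0 < r1 * r2.
  by rewrite mulr_gt0 // divr_gt0 // ?addr_gt0.
rewrite -(ltr_pM2r r0); apply: le_lt_trans le _.
by rewrite ltr_pM2l // mulr_gt0.
Qed.

Lemma turan_coef_lt0 al be k : b < 1 -> 0 < al -> 0 < be -> turan_coef al be k < 0.
Proof.
move=> b1 al0 be0; have gc := beta_coef_log_convex b1.
have g0 u : 0 < u -> 0 < g u by exact: beta_coef_gt0.
pose T m n := g (a + al + m%:R) * g (a + be + n%:R) - g (a + m%:R) * g (a + al + be + n%:R).
have pair m n : T m n + T n m < 0 by exact: log_convex_pair_lt0.
have e : turan_coef al be k = \sum_(0 <= i < k.+1) T i (k - i)%N.
  by rewrite /turan_coef /cauchy_prod -sumrB.
have e2 : turan_coef al be k = \sum_(0 <= i < k.+1) T (k - i)%N i.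
  rewrite e big_nat_rev /=; apply: eq_big_nat => i /andP[_ lei].
  by rewrite add0n subSS subKn.
(* Adding the sum to its own reversal pairs i with k - i for every i, whatever the parity of k. *)
rewrite -(pmulrn_llt0 _ (ltn0Sn 1)) mulr2n.
rewrite {1}e e2 -big_split /= big_nat_recl //.
rewrite -oppr_gt0 opprD ltr_wpDr // ?oppr_gt0 // oppr_ge0.
by apply: sumr_le0 => i _; exact/ltW.
Qed.

End turan_coefficients.

Theorem corollary1 (R : realType) (a b : R) (ha : 0 < a) (hb : 0 < b) :
  [/\ forall (alpha : nat) (beta : R), (0 < alpha)%N -> 0 < beta ->
        forall k : nat,
          psi a b alpha%:R beta k =
          \sum_(j < alpha)
            Gamma (a + b + j%:R) * Gamma (a + b + beta + alpha%:R - j%:R - 1)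
            / (Gamma b ^+ 2 * Gamma (a + j%:R + 1)
               * Gamma (a + beta + alpha%:R - j%:R))
            * (pochhammer (a + b + j%:R) k.+1 / pochhammer (a + j%:R + 1) k.+1
               - pochhammer (a + b + beta + alpha%:R - 1 - j%:R) k.+1
                 / pochhammer (a + beta + alpha%:R - j%:R) k.+1),
      b < 1 -> forall alpha beta : R, 0 < alpha -> 0 < beta ->
        forall k : nat, psi a b alpha beta k < 0
    & 1 < b -> forall (alpha : nat) (beta : R), (0 < alpha)%N ->
        alpha%:R - 1 <= beta -> 0 < beta ->
        forall k : nat, 0 < psi a b alpha%:R beta k].
Proof.
split=> [al be al0 be0 k|b1 al be al0 be0 k|b1 al be al0 albe be0 k].
- have al0' : 0 < al%:R :> R by rewrite ltr0n.
  rewrite (psiE ha hb al0' be0) (turan_coef_nat ha hb al k be0); apply: eq_bigr => j _.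
  have jal : j.+1%:R <= al%:R :> R by rewrite ler_nat.
  have j0 : 0 <= j%:R :> R by [].
  rewrite -natr1 in jal.
  have aj0 : 0 < a + j%:R by rewrite ltr_wpDr.
  pose w : R := a + be + al%:R - 1 - j%:R.
  have w0 : 0 < w by rewrite /w; lra.
  rewrite -/w (beta_coefE hb aj0) (beta_coefE hb w0).
  have -> : a + b + j%:R = a + j%:R + b by ring.
  have -> : a + b + be + al%:R - j%:R - 1 = w + b by rewrite /w; ring.
  have -> : a + b + be + al%:R - 1 - j%:R = w + b by rewrite /w; ring.
  have -> : a + be + al%:R - j%:R = w + 1 by rewrite /w; ring.
  rewrite mulf_div; congr (_ / _ * _).
  by move: (Gamma b) (Gamma _) (Gamma _) => A B C; ring.
- by rewrite psiE //; exact: turan_coef_lt0.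
- have al0' : 0 < al%:R :> R by rewrite ltr0n.
  by rewrite psiE //; exact: turan_coef_gt0.
Qed.
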